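(* If $G\in\mathcal{P}^+$, then $\chi_i^{c}(G)=7$.
   Context: Incidences and coloring: an incidence of $G$ is a pair $(v,e)$ with $v$ an endpoint of the edge $e$; for a vertex $w$, $I(w)$ is the set of incidences $(u,e)$ with $e$ incident with $w$; two incidences conflict if both lie in some $I(w)$; a conflict-free incidence $k$-coloring assigns colors from a $k$-set to incidences so that conflicting incidences get distinct colors; $\chi^{c}_i(G)$ is the least such $k$. A graph is outer-1-planar if it can be drawn in the plane with all vertices on the outer boundary and each edge crossed at most once. $K_4^+$ is $K_4$ with one edge subdivided once. Configurations (graphs): $G_2$ has vertices $u,v,w,x,y$ and edges $uv,uw,vw,vx,wy$. $G_4$ has vertices $x,y,u_0,u_1,v_0,v_1,w$ and edges $xu_1,u_1u_0,u_1v_0,u_0v_1,u_0w,v_0v_1,v_0w,v_1y$. $G_8$ has vertices $x,y,u_0,u_1,u_2,v_0,v_1$ and edges $xu_2,u_2u_1,u_2v_0,u_1u_0,u_0v_0,u_0v_1,v_0v_1,v_1y$. For $t\geq1$, $H_t$ has vertices $x',y',x_0,\dots,x_t,y_0,\dots,y_t$ and edges $x'y',x'x_0,x'y_0,y'x_0,y'y_0$, $x_{i-1}x_i$ and $y_{i-1}y_i$ for $1\le i\le t$, and $x_iy_i$ for $1\le i\le t-1$. Operations: if $z$ is a vertex of degree 2 of $G$ with neighbors $z_1,z_2$ and $t\in\{2,4,8\}$, $G\sqcup_z G_t$ is obtained by deleting $z$ and adding a disjoint copy of $G_t$ with $x$ identified with $z_1$ and $y$ with $z_2$. If $z_1z_2$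 is an edge of $G$ and $t\ge1$, $G\vee_{z_1z_2}H_t$ is obtained by deleting the edge $z_1z_2$ and adding a disjoint copy of $H_t$ with $x_t$ identified with $z_1$ and $y_t$ with $z_2$. The class $\mathcal{P}$ is the smallest class of graphs containing $K_4^+$ and closed under these operations. $\mathcal{P}^+$ is the class of connected outer-1-planar graphs with maximum degree 3 containing a subgraph isomorphic to a member of $\mathcal{P}$. *)

(* Defs.v *)
From mathcomp Require Import all_boot all_order all_algebra.
From mathcomp Require Import all_classical all_reals all_analysis.
Import numFieldNormedType.Exports.

Set Implicit Arguments.
Unset Strict Implicit.
Unset Printing Implicit Defensive.

Import Order.TTheory GRing.Theory Num.Theory.

Record sgraph := SGraph {
  vertex :> finType;
  adj : rel vertex;
  adj_sym : symmetric adj;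
  adj_irrefl : irreflexive adj }.

Notation "u -- v" := (adj u v) (at level 30, no associativity).

Section GraphOfRel.
Variables (T : finType) (r : rel T).

Definition sym_rel : rel T := [rel u v | (u != v) && (r u v || r v u)].

Lemma sym_rel_sym : symmetric sym_rel.
Proof. by move=> u v; rewrite /sym_rel /= (eq_sym u v) orbC. Qed.

Lemma sym_rel_irrefl : irreflexive sym_rel.
Proof. by move=> u; rewrite /sym_rel /= eqxx. Qed.

Definition graph_of_rel : sgraph := SGraph sym_rel_sym sym_rel_irrefl.

End GraphOfRel.

Definition graph_of_list (n : nat) (s : seq (nat * nat)) : sgraph :=
  @graph_of_rel 'I_n [rel i j : 'I_n | (nat_of_ord i, nat_of_ord j) \in s].

Definition neighbors (G : sgraph) (v : G) : {set G} := [set u | v -- u]%SET.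

Definition degree (G : sgraph) (v : G) : nat := #|neighbors v|.

Definition max_degree (G : sgraph) : nat := \max_(v : G) degree v.

Definition edges (G : sgraph) : {set {set G}} :=
  [set [set p.1; p.2]%SET | p in [set p : G * G | p.1 -- p.2]%SET]%SET.

Definition connected_graph (G : sgraph) : Prop :=
  (0 < #|G|)%N /\ forall u v : G, connect (@adj G) u v.

(* The image of such an embedding is the subgraph of G isomorphic to H; it
   need not be induced. *)
Definition has_subgraph (G H : sgraph) : Prop :=
  exists2 f : H -> G, injective f & forall u v : H, u -- v -> f u -- f v.

Section Incidence.
Variable G : sgraph.

Definition is_incidence (p : G * {set G}) : bool :=
  (p.2 \in edges G) && (p.1 \in p.2).

Definition incidence : finType := {p : G * {set G} | is_incidence p}.

Definition incidences_at (w : G) : {set incidence} :=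
  [set i : incidence | w \in (val i).2]%SET.

Definition conflict (i j : incidence) : bool :=
  (i != j) &&
  [exists w : G, (i \in incidences_at w) && (j \in incidences_at w)].

Definition cf_colorable (k : nat) : bool :=
  [exists c : {ffun incidence -> 'I_k},
     [forall i, forall j, conflict i j ==> (c i != c j)]].

Lemma cf_colorable_card : exists k, cf_colorable k.
Proof.
exists #|incidence|; apply/existsP; exists [ffun i => enum_rank i].
apply/forallP => i; apply/forallP => j; apply/implyP => /andP[ij _].
by rewrite !ffunE (inj_eq enum_rank_inj).
Qed.

Definition chi_ic : nat := ex_minn cf_colorable_card.

End Incidence.

Section Drawing.
Local Open Scope classical_set_scope.
Local Open Scope ring_scope.
Variables (R : realType) (G : sgraph).

(* [pos v] is the point representing the vertex v, and [arc e], restricted to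
   [0, 1], parametrizes the curve representing the edge e (the values of [arc]
   outside the edge set of G, or outside [0, 1], are irrelevant). *)
Variables (pos : G -> R * R) (arc : {set G} -> R -> R * R).

Definition curve (e : {set G}) : set (R * R) := arc e @` `[0, 1].

Definition open_curve (e : {set G}) : set (R * R) := arc e @` `]0, 1[.

Definition is_drawing : Prop :=
  injective pos /\
  forall e : {set G}, e \in edges G ->
    [/\ {within `[0, 1], continuous (arc e)},
        {in `[0, 1] &, injective (arc e)},
        [set arc e 0; arc e 1] = pos @` [set` e] &
        forall v : G, ~ open_curve e (pos v)].

(* The crossings on e, each given by the other edge and the crossing point.
   Recording the other edge means that a point common to three edges amounts
   to two crossings on each of them. A point where two edges touch also counts
   as a crossing. *)
Definition crossings (e : {set G}) : set ({set G} * (R * R)) :=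
  [set c | [/\ c.1 \in edges G, c.1 != e,
               open_curve e c.2 & open_curve c.1 c.2]].

Definition drawing_support : set (R * R) :=
  range pos `|` \bigcup_(e in [set` edges G]) curve e.

(* The unbounded component of the complement of the drawing, which is unique
   since the drawing is compact. *)
Definition outer_face : set (R * R) :=
  [set p | (~` drawing_support) p /\
           ~ bounded_set (connected_component (~` drawing_support) p)].

Definition outer_boundary : set (R * R) :=
  closure outer_face `\` interior outer_face.

Definition outer_1_plane : Prop :=
  [/\ is_drawing,
      forall v : G, outer_boundary (pos v) &
      forall e : {set G}, e \in edges G -> is_subset1 (crossings e)].

End Drawing.

Definition outer_1_planar (R : realType) (G : sgraph) : Prop :=
  exists (pos : G -> R * R) (arc : {set G} -> R -> R * R),
    outer_1_plane pos arc.

Definition K4_plus : sgraph :=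
  let a := 0 in let b := 1 in let c := 2 in let d := 3 in let s := 4 in
  graph_of_list 5
    [:: (a, s); (s, b); (a, c); (a, d); (b, c); (b, d); (c, d)].

Record linked_graph := LinkedGraph {
  lgraph :> sgraph;
  link1 : lgraph;
  link2 : lgraph }.

Definition G_2 : linked_graph :=
  let x := 0 in let y := 1 in let u := 2 in let v := 3 in let w := 4 in
  @LinkedGraph
    (graph_of_list 5 [:: (u, v); (u, w); (v, w); (v, x); (w, y)])
    (inord 0 : 'I_5) (inord 1 : 'I_5).

Definition G_4 : linked_graph :=
  let x := 0 in let y := 1 in let u0 := 2 in let u1 := 3 in
  let v0 := 4 in let v1 := 5 in let w := 6 in
  @LinkedGraph
    (graph_of_list 7 [:: (x, u1); (u1, u0); (u1, v0); (u0, v1);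
                         (u0, w); (v0, v1); (v0, w); (v1, y)])
    (inord 0 : 'I_7) (inord 1 : 'I_7).

Definition G_8 : linked_graph :=
  let x := 0 in let y := 1 in let u0 := 2 in let u1 := 3 in
  let u2 := 4 in let v0 := 5 in let v1 := 6 in
  @LinkedGraph
    (graph_of_list 7 [:: (x, u2); (u2, u1); (u2, v0); (u1, u0);
                         (u0, v0); (u0, v1); (v0, v1); (v1, y)])
    (inord 0 : 'I_7) (inord 1 : 'I_7).

(* Vertices of H_t: x' = (false, None), y' = (true, None),
   x_i = (false, Some i), y_i = (true, Some i). *)
Definition H_vertex (t : nat) : finType := (bool * option 'I_t.+1)%type.

Definition H_rel (t : nat) : rel (H_vertex t) := fun p q =>
  match p, q with
  | (a, None), (b, None) => a != b
  | (_, None), (_, Some i) => i == 0 :> nat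
  | (a, Some i), (b, Some j) =>
      (a == b) && (i.+1 == j :> nat)
      || [&& a != b, i == j, 1 <= i & i <= t.-1]
  | _, _ => false
  end.

Definition H_ (t : nat) : linked_graph :=
  @LinkedGraph (graph_of_rel (@H_rel t))
    ((false, Some ord_max) : H_vertex t) ((true, Some ord_max) : H_vertex t).

Definition del_vertex (G : sgraph) (z : G) : sgraph :=
  @graph_of_rel {v : G | v != z} [rel u v | val u -- val v].

Definition del_edge (G : sgraph) (z1 z2 : G) : sgraph :=
  @graph_of_rel G
    [rel u v | (u -- v) && ([set u; v]%SET != [set z1; z2]%SET)].

(* The disjoint union of A and B in which link1 B is identified with z1 and
   link2 B with z2. *)
Section Attach.
Variables (A : sgraph) (B : linked_graph) (z1 z2 : A).

Definition attach_vertex : finType :=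
  (A + {b : B | (b != link1 B) && (b != link2 B)})%type.

Definition represents (b : B) (p : attach_vertex) : bool :=
  match p with
  | inl a => (b == link1 B) && (a == z1) || (b == link2 B) && (a == z2)
  | inr c => b == val c
  end.

Definition attach_rel : rel attach_vertex := fun p q =>
  match p, q with
  | inl a, inl a' => a -- a'
  | _, _ => false
  end
  || [exists b : B, exists c : B, [&& b -- c, represents b p & represents c q]].

Definition attach : sgraph := graph_of_rel attach_rel.

End Attach.

Definition G_config (B : linked_graph) : Prop :=
  [\/ B = G_2, B = G_4 | B = G_8].

Inductive class_P : sgraph -> Prop :=
| P_K4_plus : class_P K4_plus
| P_sqcup (G : sgraph) (z : G) (z1 z2 : del_vertex z) (B : linked_graph) :
    class_P G -> degree z = 2 ->
    z1 != z2 -> z -- val z1 -> z -- val z2 -> G_config B ->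
    class_P (@attach (del_vertex z) B z1 z2)
| P_vee (G : sgraph) (z1 z2 : G) (t : nat) :
    class_P G -> z1 -- z2 -> (1 <= t)%N ->
    class_P (@attach (del_edge z1 z2) (H_ t) z1 z2).

Definition class_P_plus (R : realType) (G : sgraph) : Prop :=
  [/\ connected_graph G, outer_1_planar R G, max_degree G = 3 &
      exists2 H : sgraph, class_P H & has_subgraph G H].

(* Main.v *)
(* A conflict-free incidence k-coloring amounts to giving each edge a pair of
   the k colors so that adjacent edges receive disjoint pairs.

   Six colors do not suffice: with six colors a vertex of degree 3 sees every
   color exactly once, and counting occurrences of a color shows that K_4^+ has
   no such coloring, that the pairs on the two edges leaving G_2, G_4 or G_8 are
   disjoint (so that they color the two edges at the vertex z), and that the
   pairs on the two edges leaving H_t are equal (so that they color z_1z_2).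

   Seven colors suffice for every graph of maximum degree at most 3; planarity
   plays no role. Triangles are removed by induction, contracting them or, if
   two of them share an edge, deleting edges. In a triangle-free graph take a
   partial proper 3-edge-coloring s with the fewest uncolored edges. By a Kempe
   chain argument the uncolored edges form a matching. If ab is uncolored, with
   x missing at a and y missing at b, let avw be the path starting at a with an
   edge of color y followed by one of color x: recoloring along it makes vw
   uncolored instead of ab. The sets {a,b,v,w} obtained from distinct uncolored
   edges are disjoint, since otherwise recoloring along two such paths would
   create adjacent uncolored edges. Doing all these recolorings at once gives a
   second partial coloring s'. The edges uncolored in s or in s' form a matching,
   and none is uncolored in both, so three colors from s, three from s', and a
   seventh one for that matching give each edge two colors. *)

Require Import Defs.
From mathcomp Require Import all_boot all_reals.
From mathcomp Require Import perm zify boolp.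

Set Implicit Arguments.
Unset Strict Implicit.
Unset Printing Implicit Defensive.

(** * Partial 3-edge-colorings *)

Lemma subset_extend (T : finType) (A B : {set T}) k :
  A \subset B -> #|A| <= k <= #|B| ->
  exists D : {set T}, [/\ A \subset D, D \subset B & #|D| = k].
Proof.
elim: k => [|k IH] AB /andP[Ak kB].
  by exists A; split=> //; apply/eqP; rewrite -leqn0.
have [Ak'|kA] := leqP #|A| k; last first.
  by exists A; split=> //; apply/eqP; rewrite eqn_leq Ak.
have [|D [AD DB Dk]] := IH AB; first by rewrite Ak' ltnW.
have /card_gt0P[x] : 0 < #|B :\: D|.
  by rewrite cardsD (setIidPr DB) Dk subn_gt0.
rewrite inE => /andP[xD xB]; exists (x |: D); split.
- by apply: subset_trans AD (subsetUr _ _).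
- by rewrite subUset sub1set xB.
- by rewrite cardsU1 xD Dk.
Qed.

Definition subcubic (T : finType) (r : rel T) : Prop :=
  forall u : T, #|[set v | r u v]| <= 3.

Section PartialColoring.
Variables (T : finType) (r : rel T).
Hypotheses (rS : symmetric r) (rI : irreflexive r).

(* A partial proper 3-edge-coloring, given by three matchings; the vertices
   fixed by [s i] are those at which the color i is missing. *)
Definition coloring (s : 'I_3 -> T -> T) : Prop :=
  [/\ forall i, involutive (s i),
      forall i u, s i u != u -> r u (s i u) &
      forall i j u, s i u = s j u -> s i u != u -> i = j].

Definition uncolored (s : 'I_3 -> T -> T) : rel T :=
  fun u v => r u v && [forall i, s i u != v].

Definition same_edge (u v a b : T) : bool :=
  (u == a) && (v == b) || (u == b) && (v == a).

(** This composes the matching [s i] with the transposition of [a] and [b]. It gives color [i] to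
    the edge [ab] when both ends miss [i], and removes it when [s i] exchanges them. *)
Definition toggle (i : 'I_3) (a b : T) (s : 'I_3 -> T -> T) : 'I_3 -> T -> T :=
  fun j u => if j == i then (if u == a then s i b else if u == b then s i a else s i u)
             else s j u.

Lemma same_edgeC u v a b : same_edge u v b a = same_edge u v a b.
Proof. by rewrite /same_edge orbC. Qed.

Lemma uncoloredC s : coloring s -> symmetric (uncolored s).
Proof.
case=> sK _ _ u v; rewrite /uncolored rS; congr (_ && _).
by apply/forallP/forallP => H i; apply: contraNneq (H i) => <-; rewrite sK.
Qed.

Lemma uncoloredPn s u v : r u v ->
  reflect (exists i, s i u = v) (~~ uncolored s u v).
Proof.
move=> ruv; rewrite /uncolored ruv /= negb_forall.
by apply: (iffP existsP) => -[i]; rewrite ?negbK => /eqP E; exists i; rewrite ?negbK.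
Qed.

Lemma color_edge s i a b : coloring s -> uncolored s a b ->
  s i a = a -> s i b = b ->
  coloring (toggle i a b s) /\
  forall u v, uncolored (toggle i a b s) u v = uncolored s u v && ~~ same_edge u v a b.
Proof.
move=> [sK sr si] Uab sa sb.
have /andP[rab /forallP Nab] := Uab.
have ab : a != b by apply: contraTneq rab => ->; rewrite rI.
have Na j : s j a != b by apply: Nab.
have Nb j : s j b != a by apply: contraNneq (Nab j) => <-; rewrite sK.
split.
  split.
  - move=> j u; rewrite /toggle; case: (j =P i) => [_|_]; last exact: sK.
    rewrite sa sb; case: (u =P a) => [->|ua].
      by rewrite (eq_sym b) (negbTE ab) eqxx.
    case: (u =P b) => [->|ub]; first by rewrite eqxx.
    case: (s i u =P a) => [E|_]; first by case: ua; rewrite -(sK i u) E sa.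
    case: (s i u =P b) => [E|_]; first by case: ub; rewrite -(sK i u) E sb.
    exact: sK.
  - move=> j u; rewrite /toggle; case: (j =P i) => [_|_]; last exact: sr.
    rewrite sa sb; case: (u =P a) => [->|ua] //.
    case: (u =P b) => [->|ub]; first by rewrite rS.
    exact: sr.
  - move=> j k u; rewrite /toggle sa sb.
    case: (j =P i) => [->|ji]; case: (k =P i) => [->|ki] //.
    + case: (u =P a) => [->|_]; first by move=> E; case/eqP: (Na k).
      case: (u =P b) => [->|_]; first by move=> E; case/eqP: (Nb k).
      exact: si.
    + case: (u =P a) => [->|_]; first by move=> E; case/eqP: (Na j).
      case: (u =P b) => [->|_]; first by move=> E; case/eqP: (Nb j).
      exact: si.
    + exact: si.
move=> u v; rewrite /uncolored /same_edge /toggle.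
case ruv: (r u v) => //=.
apply/forallP/andP => [H|[/forallP H E] j].
  split.
    apply/forallP => j; move: (H j); case: (j =P i) => // ->.
    rewrite sa sb; case: (u =P a) => [ua _|_].
      by rewrite ua sa; apply: contraTneq ruv => <-; rewrite ua rI.
    case: (u =P b) => [ub _|_ //].
    by rewrite ub sb; apply: contraTneq ruv => <-; rewrite ub rI.
  move: (H i); rewrite eqxx sa sb.
  case: (u =P a) => [->|ua]; first by rewrite (negbTE ab) orbF (eq_sym v).
  by case: (u =P b) => [_|_] //=; rewrite (eq_sym v).
move: (H j); case: (j =P i) => // ->.
rewrite sa sb; case: (u =P a) => [ua|ua] _.
  by apply: contraNneq E => <-; rewrite ua !eqxx.
case: (u =P b) => [ub|ub]; last exact: H.
by apply: contraNneq E => <-; rewrite ub !eqxx orbT.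
Qed.

Lemma uncolor_edge s i a b : coloring s -> s i a = b -> a != b ->
  coloring (toggle i a b s) /\
  forall u v, uncolored (toggle i a b s) u v = uncolored s u v || same_edge u v a b.
Proof.
move=> [sK sr si] sa ab.
have sb : s i b = a by rewrite -sa sK.
have rab : r a b by rewrite -sa sr // sa eq_sym.
have Ta u : toggle i a b s i u = if (u == a) || (u == b) then u else s i u.
  rewrite /toggle eqxx sa sb; case: (u =P a) => [->|_] //.
  by case: (u =P b) => [->|_].
have Tj j u : j != i -> toggle i a b s j u = s j u.
  by rewrite /toggle => /negbTE->.
split.
  split.
  - move=> j u; have [->|ji] := eqVneq j i; last by rewrite !Tj // sK.
    rewrite (Ta u); case: ifPn => [Eu|/norP[ua ub]]; rewrite Ta ?Eu //.
    have -> : (s i u == a) = (u == b) by rewrite -sb (inj_eq (can_inj (sK i))).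
    have -> : (s i u == b) = (u == a) by rewrite -sa (inj_eq (can_inj (sK i))).
    by rewrite (negbTE ua) (negbTE ub) sK.
  - move=> j u; have [->|ji] := eqVneq j i; last by rewrite !Tj //; apply: sr.
    by rewrite Ta; case: ifP => [_|_]; [rewrite eqxx|apply: sr].
  - move=> j k u; have [->|ji] := eqVneq j i; have [->|ki] := eqVneq k i => //.
    + by rewrite Ta Tj //; case: ifP => [_|_ E /(si _ _ _ E)]; [rewrite eqxx|].
    + by rewrite Ta Tj //; case: ifP => [_ ->|_ E /(si _ _ _ E)]; [rewrite eqxx|].
    + by rewrite !Tj //; apply: si.
move=> u v; rewrite /uncolored.
case ruv: (r u v) => /=; last first.
  apply/esym/negbTE; apply: contraFN ruv.
  by case/orP=> /andP[/eqP-> /eqP->] //; rewrite rS.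
have uv : u != v by apply: contraTneq ruv => ->; rewrite rI.
apply/forallP/idP => [H|].
  case E: (same_edge u v a b); rewrite ?orbT // orbF.
  apply/forallP => j; move: (H j).
  have [->|ji] := eqVneq j i; last by rewrite Tj.
  rewrite Ta; case: ifP => // Eu _.
  apply: contraFN E => /eqP <-.
  by case/orP: Eu => /eqP->; rewrite /same_edge ?sa ?sb !eqxx ?orbT.
case/orP => [/forallP H|E] j.
  have [->|ji] := eqVneq j i; last by rewrite Tj.
  by rewrite Ta; case: ifP.
have [->|ji] := eqVneq j i.
  by rewrite Ta; case/orP: E => /andP[-> _] //=; rewrite ?orbT.
rewrite Tj //; apply: contraNneq ji => sj; apply/eqP/(si _ _ u).
  by case/orP: E => /andP[/eqP Eu /eqP Ev]; rewrite sj Eu Ev.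
by rewrite sj eq_sym.
Qed.

(** * Optimal colorings *)

Definition num_uncolored (s : 'I_3 -> T -> T) : nat :=
  #|[set p : T * T | uncolored s p.1 p.2]|.

Definition optimal (s : 'I_3 -> T -> T) : Prop :=
  coloring s /\ forall s', coloring s' -> num_uncolored s <= num_uncolored s'.

Lemma exists_optimal : exists s, optimal s.
Proof.
have H : exists n, `[< exists s, coloring s /\ num_uncolored s = n >].
  exists (num_uncolored (fun _ u => u)); apply/asboolP.
  exists (fun _ u => u); split=> //; split=> //.
  - by move=> i u; rewrite eqxx.
  - by move=> i j u _; rewrite eqxx.
case: (ex_minnP H) => n /asboolP[s [cs <-]] Hmin.
by exists s; split=> // s' cs'; apply: Hmin; apply/asboolP; exists s'.
Qed.

(** Otherwise [i] would be missing at both ends and could be given to [ab], against minimality. *)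
Lemma optimal_missing s i a b : optimal s -> uncolored s a b ->
  s i a = a -> s i b != b.
Proof.
move=> [cs omin] Uab sa; apply/eqP => sb.
have [cs' U'] := color_edge cs Uab sa sb.
have := omin _ cs'; rewrite leqNgt => /negP; apply; apply: proper_card.
apply/properP; split.
  by apply/fintype.subsetP => p; rewrite !inE U' => /andP[].
by exists (a, b); rewrite !inE //= U' /same_edge !eqxx andbF.
Qed.

Lemma coloring_neq s i u : coloring s -> s i u != u -> r u (s i u).
Proof. by case=> _ sr _; apply: sr. Qed.

(** * Moving an uncolored edge along an alternating path *)

(** Color [y] is taken from the edge joining [a] to [s y a] and given to [ab]. The last conclusions
    delimit the change, so that further steps can be chained. *)
Lemma rotate_step s y a b : coloring s -> uncolored s a b ->
  s y b = b -> s y a != a ->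
  exists s', [/\ coloring s', num_uncolored s' <= num_uncolored s,
    forall u v, uncolored s' u v =
      uncolored s u v && ~~ same_edge u v a b || same_edge u v a (s y a),
    forall j u, u \notin [:: a; b; s y a] -> s' j u = s j u &
    (forall j u, j != y -> s' j u = s j u) /\ s' y (s y a) = s y a].
Proof.
move=> cs Uab sb; set v := s y a => va.
have sK : involutive (s y) by case: cs => + _ _; exact.
have /andP[rab /forallP Nab] := Uab.
have ab : a != b by apply: contraTneq rab => ->; rewrite rI.
have bv : b != v by rewrite eq_sym Nab.
have av : a != v by rewrite eq_sym.
have sv : s y v = a by rewrite /v sK.
have [cs1 U1] := uncolor_edge cs (erefl v) av.
set s1 := toggle y a v s in cs1 U1.
have s1a : s1 y a = a by rewrite /s1 /toggle !eqxx sv.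
have s1b : s1 y b = b.
  by rewrite /s1 /toggle eqxx (eq_sym b) (negbTE ab) (negbTE bv).
have U1ab : uncolored s1 a b by rewrite U1 Uab.
have [cs2 U2] := color_edge cs1 U1ab s1a s1b.
have E u w : uncolored (toggle y a b s1) u w =
      uncolored s u w && ~~ same_edge u w a b || same_edge u w a v.
  rewrite U2 U1 andb_orl; congr (_ || _).
  case E : (same_edge u w a v) => //=; apply/negP => F.
  case/orP: F => /andP[/eqP Eu /eqP Ew]; move: E; rewrite /same_edge Eu Ew.
    by rewrite (negbTE bv) (negbTE av) /= ?andbF.
  by rewrite (negbTE bv) ?andbF orbF eq_sym (negbTE ab).
exists (toggle y a b s1); split=> //.
- rewrite /num_uncolored.
  (* [num_uncolored] counts ordered pairs: both orientations of [ab] leave the set and both of [av]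
     enter it. *)
  have D : [set (a, b); (b, a)] \subset [set p : T * T | uncolored s p.1 p.2].
    by apply/fintype.subsetP => p; rewrite !inE => /orP[]/eqP->//=; rewrite uncoloredC.
  have -> : [set p : T * T | uncolored (toggle y a b s1) p.1 p.2] =
      ([set p : T * T | uncolored s p.1 p.2] :\: [set (a, b); (b, a)])
        :|: [set (a, v); (v, a)].
    apply/setP => -[p q]; rewrite !inE E /same_edge !xpair_eqE /=.
    by rewrite andbC.
  apply: leq_trans (leq_card_setU _ _) _.
  rewrite cardsD (setIidPr D) !cards2 !xpair_eqE (negbTE ab) (negbTE av) /=.
  by have := subset_leq_card D; rewrite cards2 xpair_eqE (negbTE ab) /=; lia.
- move=> j u; rewrite !inE => /norP[ua /norP[ub uv]].
  rewrite /s1 /toggle (negbTE ua) (negbTE ub) (negbTE uv).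
  by case: (eqVneq j y) => [->|_] //; rewrite eqxx.
- split=> [j u jy|]; first by rewrite /s1 /toggle (negbTE jy).
  rewrite /toggle eqxx (negbTE va) (eq_sym v) (negbTE bv).
  by rewrite /s1 /toggle eqxx (negbTE va) eqxx.
Qed.

Lemma optimal_le s s' : optimal s -> coloring s' ->
  num_uncolored s' <= num_uncolored s -> optimal s'.
Proof. by case=> _ omin cs' le; split=> // t /omin; apply: leq_trans. Qed.

(* Walking along the alternating path that starts at an end of an uncolored
   edge [a b]: its first two edges are [a v] and [v w]. *)
Definition rotatable s (x y : 'I_3) (a b v w : T) : Prop :=
  [/\ uncolored s a b, s x a = a /\ s y b = b, s y a = v, s x v = w &
      v != a /\ w != v].

Lemma rotate1 s x y a b v w : coloring s -> rotatable s x y a b v w ->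
  exists s', [/\ coloring s', num_uncolored s' <= num_uncolored s,
    forall p q, uncolored s' p q =
      uncolored s p q && ~~ same_edge p q a b || same_edge p q a v &
    forall j u, u \notin [:: a; b; v] -> s' j u = s j u].
Proof.
move=> cs [Uab [sa sb] Ev Ew [va wv]]; rewrite -Ev in va.
by have [s' []] := rotate_step cs Uab sb va; rewrite Ev => *; exists s'.
Qed.

Lemma rotatable_colored s x y a b v w : coloring s -> rotatable s x y a b v w ->
  ~~ uncolored s a v /\ ~~ uncolored s v w.
Proof.
move=> cs [Uab [sa sb] Ev Ew [va wv]]; split; apply/negP => /andP[_ /forallP].
  by move=> /(_ y); rewrite Ev eqxx.
by move=> /(_ x); rewrite Ew eqxx.
Qed.

(** After the first step [va] is uncolored and [x] is still missing at [a], so the same step applies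
    to [va] with color [x]. *)
Lemma rotate2 s x y a b v w : coloring s -> rotatable s x y a b v w ->
  exists s', [/\ coloring s', num_uncolored s' <= num_uncolored s,
    forall p q, uncolored s' p q =
      uncolored s p q && ~~ same_edge p q a b || same_edge p q v w &
    forall j u, u \notin [:: a; b; v; w] -> s' j u = s j u].
Proof.
move=> cs /[dup] R [Uab [sa sb] Ev Ew [va wv]]; rewrite -Ev in va.
have [s1 [cs1 le1 U1 F1 [G1 H1]]] := rotate_step cs Uab sb va.
rewrite Ev in va U1 F1 H1.
have xy : x != y by apply: contraTneq va => E; rewrite -Ev -E sa eqxx.
have s1a : s1 x a = a by rewrite G1.
have s1v : s1 x v = w by rewrite G1.
have U1va : uncolored s1 v a.
  by rewrite (uncoloredC cs1) U1 /same_edge !eqxx orbT.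
have s1v' : s1 x v != v by rewrite s1v.
have [s2 [cs2 le2 U2 F2 _]] := rotate_step cs1 U1va s1a s1v'.
exists s2; split=> //; first exact: leq_trans le1.
  move=> p q; rewrite U2 s1v; congr (_ || _).
  rewrite U1 (same_edgeC p q a v) andb_orl andbN orbF.
  case E : (same_edge p q a v); last by rewrite andbT.
  (* The edge [av] is uncolored only in between: it is colored in [s], and the second step gives it
     [x]. *)
  have [Nav _] := rotatable_colored cs R.
  rewrite andbF; apply/esym/negbTE; rewrite negb_and; apply/orP; left.
  by case/orP: E => /andP[/eqP-> /eqP->] //; rewrite uncoloredC.
move=> j u; rewrite !inE => /norP[ua /norP[ub /norP[uv uw]]].
have N1 : u \notin [:: a; b; v] by rewrite !inE !negb_or ua ub.
have N2 : u \notin [:: v; a; s1 x v] by rewrite !inE s1v !negb_or uv ua.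
by rewrite F2 // F1.
Qed.

(** * Kempe changes and alternating paths *)

Definition kempe (x y : 'I_3) (S : {set T}) (s : 'I_3 -> T -> T) : 'I_3 -> T -> T :=
  fun i u => if u \in S then s (tperm x y i) u else s i u.

(** An edge of color [x] or [y] has both ends in [S] or both outside, so its ends see the same
    exchange; the transposition fixes the other color. *)
Lemma kempe_coloring x y (S : {set T}) s : coloring s ->
  (forall u, u \in S -> s x u \in S) -> (forall u, u \in S -> s y u \in S) ->
  coloring (kempe x y S s) /\ uncolored (kempe x y S s) =2 uncolored s.
Proof.
move=> [sK sr si] Sx Sy.
have SE i u : i \in [:: x; y] -> (s i u \in S) = (u \in S).
  rewrite !inE => ixy; apply/idP/idP => [H|H].
    by rewrite -(sK i u); case/orP: ixy H => /eqP->; [apply: Sx|apply: Sy].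
  by case/orP: ixy => /eqP->; [apply: Sx|apply: Sy].
have tE i : i \notin [:: x; y] -> tperm x y i = i.
  by rewrite !inE => /norP[ix iy]; rewrite tpermD // eq_sym.
have tM i : (tperm x y i \in [:: x; y]) = (i \in [:: x; y]).
  by rewrite !inE; case: tpermP => [->|->|//]; rewrite !eqxx ?orbT.
split; first split.
- move=> i u; rewrite /kempe; case: (boolP (u \in S)) => uS.
    case: ifPn => [_|suS]; first exact: sK.
    have ixy : i \notin [:: x; y].
      by rewrite -tM; apply: contraNN suS => txy; rewrite SE.
    by rewrite tE // sK.
  case: ifPn => [suS|_]; last exact: sK.
  have ixy : i \notin [:: x; y] by apply: contraNN uS => ixy; rewrite -(SE i).
  by rewrite tE // sK.
- by move=> i u; rewrite /kempe; case: ifP => _; apply: sr.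
- move=> i j u; rewrite /kempe; case: ifP => _ E N; last exact: si E N.
  exact: perm_inj (si _ _ _ E N).
move=> u v; rewrite /uncolored /kempe; congr (_ && _).
case: (u \in S) => //; apply/forallP/forallP => H i //.
by have := H (tperm x y i); rewrite tpermK.
Qed.

Section AlternatingPath.
Variables (f g : T -> T) (a : T).
Hypotheses (fK : involutive f) (gK : involutive g) (fa : f a = a).

Let step := f \o g.

Lemma step_inj : injective step.
Proof. by apply: inj_comp; apply: inv_inj. Qed.

(** Conjugation by [f] turns [step] into its inverse [g \o f], and [f] fixes [a]. *)
Lemma iter_step_reflect k : iter k step (f (iter k step a)) = a.
Proof.
elim: k => [|k IH] //; rewrite (iterSr _ _ (f _)) iterS.
by rewrite -[step (f _)]/(f (g (f (f (g (iter k step a)))))) fK gK.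
Qed.

(** By the reflection above, [f] preserves the orbit of [a], and [g u = f (step u)]. *)
Lemma alternating_path_closed u : u \in fconnect step a ->
  (f u \in fconnect step a) /\ (g u \in fconnect step a).
Proof.
have fC w : w \in fconnect step a -> f w \in fconnect step a.
  move=> /iter_findex <-; set k := findex _ _ _.
  rewrite inE fconnect_sym; last exact: step_inj.
  by have := fconnect_iter step k (f (iter k step a)); rewrite iter_step_reflect.
move=> ua; split; first exact: fC.
rewrite -(fK (g u)); apply: fC; apply: connect_trans ua _; exact: fconnect1.
Qed.

(* The vertices of the path are the [iter k step a]; if the one of index [i]
   is fixed by [g] then [step] has odd period [2i+1] there. *)
Lemma alternating_path_end b c : b \in fconnect step a -> c \in fconnect step a ->
  g b = b -> g c = c -> b = c.
Proof.
have per u k : u = iter k step a -> g u = u -> iter k.*2.+1 step a = a.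
  move=> Eu gu; rewrite -addnn -addnS iterD iterS -Eu -[step u]/(f (g u)) gu Eu.
  exact: iter_step_reflect.
have mul m k : iter m step a = a -> iter (k * m) step a = a.
  by move=> E; elim: k => // k IH; rewrite mulSn iterD IH.
move=> /iter_findex/esym Eb /iter_findex/esym Ec gb gc.
set i := findex _ _ b in Eb; set j := findex _ _ c in Ec.
have pb := per _ _ Eb gb; have pc := per _ _ Ec gc.
(* Both exponents equal [2ij + i + j], and the added multiples are periods at [a]. *)
have : iter (i + j * i.*2.+1) step a = iter (j + i * j.*2.+1) step a.
  by congr iter; lia.
by rewrite !iterD !mul // -Eb -Ec.
Qed.

End AlternatingPath.

Hypothesis r3 : subcubic r.

(** * Uncolored edges form a matching *)

(** Three colored edges and an uncolored one would give [b] four neighbors. *)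
Lemma missing_color s a b : coloring s -> uncolored s b a -> exists i, s i b = b.
Proof.
move=> [sK sr si] /andP[rba /forallP Nba].
have [/existsP[i /eqP]|] := boolP [exists i, s i b == b]; first by exists i.
rewrite negb_exists => /forallP N; exfalso.
have := r3 b; rewrite leqNgt => /negP; apply.
have inj : injective (fun i => s i b) by move=> i j E; apply: si E (N i).
have <- : #|a |: [set s i b | i : 'I_3]| = 4.
  rewrite cardsU1 card_imset // card_ord.
  by case: imsetP => // -[i _ E]; move: (Nba i); rewrite -E eqxx.
apply: subset_leq_card; rewrite subUset sub1set inE rba /=.
by apply/fintype.subsetP => _ /imsetP[i _ ->]; rewrite inE sr.
Qed.

(** If [b] and [c] differed, a single color [y] would be present at [a] and missing at both of them.
    For another color [x], the path from [a] alternating in [y] and [x] must contain [b] and [c],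
    yet only one of its vertices can miss [y]. *)
Lemma optimal_matching s a b c : optimal s -> uncolored s a b -> uncolored s a c ->
  b = c.
Proof.
move=> os Uab Uac; apply/eqP/negPn/negP => bc.
have [cs _] := os; have [sK sr si] := cs.
have [y sb] : exists y, s y b = b by apply: (missing_color cs (a := a)); rewrite uncoloredC.
have [y' sc] : exists y, s y c = c by apply: (missing_color cs (a := a)); rewrite uncoloredC.
have /andP[rab /forallP Nab] := Uab; have /andP[rac /forallP Nac] := Uac.
(* Besides [ab] and [ac] there is at most one edge at [a], so at most one color is present there. *)
have one i j : s i a != a -> s j a != a -> i = j.
  move=> Ni Nj; apply/eqP/negPn/negP => ij.
  have := r3 a; rewrite leqNgt => /negP; apply.
  have U4 : uniq [:: b; c; s i a; s j a].
    rewrite /= !inE !negb_or bc (eq_sym b) (eq_sym b) (eq_sym c) (eq_sym c).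
    rewrite !Nab !Nac /= andbT; apply: contraNneq ij => E.
    by apply/eqP; apply: si E Ni.
  rewrite -[4]/(size [:: b; c; s i a; s j a]) -(card_uniqP U4).
  apply: subset_leq_card; apply/fintype.subsetP => u; rewrite !inE.
  by case/or4P => /eqP->; rewrite ?sr.
have sya : s y a != a.
  by rewrite uncoloredC // in Uab; apply: (optimal_missing os Uab).
have sya' : s y' a != a.
  by rewrite uncoloredC // in Uac; apply: (optimal_missing os Uac).
have Ey := one _ _ sya sya'; subst y'.
have [x xy] : exists x, x != y.
  by exists (if y == ord0 then ord_max else ord0); case: (y =P ord0) => [->|/eqP]; rewrite // eq_sym.
have sxa : s x a = a by apply/eqP/negPn; apply: contraNN xy => N; rewrite (one _ _ N sya).
set P := [set u | u \in fconnect (s x \o s y) a].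
(* If [d] were off the path, exchanging [x] and [y] along it would make [y] missing at [a] as well
   as at [d]. *)
have reach d : uncolored s a d -> s y d = d -> d \in P.
  move=> Uad sd; apply/negPn/negP => dP.
  have cl := alternating_path_closed (sK x) (sK y) sxa.
  have [||cs' U'] := @kempe_coloring x y P s cs.
  - by move=> u; rewrite !in_set => /cl[].
  - by move=> u; rewrite !in_set => /cl[].
  have os' : optimal (kempe x y P s).
    apply: optimal_le os cs' _; rewrite /num_uncolored.
    by apply: eq_leq; apply: eq_card => p; rewrite !inE U'.
  have Uad' : uncolored (kempe x y P s) a d by rewrite U'.
  have aP : a \in P by rewrite in_set; apply: connect0.
  have := optimal_missing (i := y) os' Uad'.
  by rewrite /kempe aP (negbTE dP) tpermR sd eqxx => /(_ sxa).
case/eqP: bc; apply: (alternating_path_end (sK x) (sK y) sxa _ _ sb sc).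
  by have := reach b Uab sb; rewrite in_set.
by have := reach c Uac sc; rewrite in_set.
Qed.

(** * Disjointness of the rotated paths *)

(** The matching property excludes [a] and [b]. If [c] were [v] or [w], moving [ab] to [av] or to
    [vw] would create two adjacent uncolored edges. *)
Lemma rotatable_avoid s x y a b v w c d : optimal s -> rotatable s x y a b v w ->
  uncolored s c d -> ~~ same_edge c d a b -> c \notin [:: a; b; v; w].
Proof.
move=> os R Ucd N; have [cs _] := os; have [Uab [sa sb] Ev Ew [va wv]] := R.
have [Nav Nvw] := rotatable_colored cs R.
have Uba : uncolored s b a by rewrite uncoloredC.
rewrite !inE !negb_or; apply/and4P; split.
- apply: contraNneq N => E; rewrite E in Ucd *.
  by rewrite (optimal_matching os Ucd Uab) /same_edge !eqxx.
- apply: contraNneq N => E; rewrite E in Ucd *.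
  by rewrite (optimal_matching os Ucd Uba) /same_edge !eqxx orbT.
- have [s1 [cs1 le1 U1 _]] := rotate1 cs R.
  have os1 := optimal_le os cs1 le1.
  apply: contraNneq Nav => E; rewrite -E (uncoloredC cs).
  have U1cd : uncolored s1 c d by rewrite U1 Ucd N.
  have U1ca : uncolored s1 c a by rewrite U1 E /same_edge !eqxx !orbT.
  by rewrite -(optimal_matching os1 U1cd U1ca).
- have [s1 [cs1 le1 U1 _]] := rotate2 cs R.
  have os1 := optimal_le os cs1 le1.
  apply: contraNneq Nvw => E; rewrite -E (uncoloredC cs).
  have U1cd : uncolored s1 c d by rewrite U1 Ucd N.
  have U1cv : uncolored s1 c v by rewrite U1 E /same_edge !eqxx !orbT.
  by rewrite -(optimal_matching os1 U1cd U1cv).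
Qed.

Lemma rotatable_transfer s s' x y a b v w : rotatable s x y a b v w ->
  uncolored s' a b -> (forall i u, u \in [:: a; b; v] -> s' i u = s i u) ->
  rotatable s' x y a b v w.
Proof.
move=> [Uab [sa sb] Ev Ew N] U' F.
by split=> //; [split|..]; rewrite F // !inE eqxx ?orbT.
Qed.

Lemma same_edge_sym a b c d : same_edge a b c d = same_edge c d a b.
Proof.
by rewrite /same_edge (eq_sym a c) (eq_sym b d) (eq_sym a d) (eq_sym b c) [(d == a) && _]andbC.
Qed.

Lemma same_edge_swap u v a b : same_edge v u a b = same_edge u v a b.
Proof. by rewrite same_edge_sym same_edgeC same_edge_sym. Qed.

(* If the two paths met, rotating both uncolored edges up to the meeting point
   would produce two adjacent uncolored edges in an optimal coloring. *)
Lemma rotatable_disjoint s x y a b v w x' y' c d v' w' : optimal s ->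
  rotatable s x y a b v w -> rotatable s x' y' c d v' w' ->
  ~~ same_edge c d a b -> ~~ has [in [:: a; b; v; w]] [:: c; d; v'; w'].
Proof.
move=> os R R' N; have [cs _] := os.
have [Uab _ _ _ _] := R; have [Ucd [sc sd] Ev' Ew' [vc' wv']] := R'.
have N' : ~~ same_edge a b c d by rewrite same_edge_sym.
have Uba : uncolored s b a by rewrite uncoloredC.
have Udc : uncolored s d c by rewrite uncoloredC.
have cV := rotatable_avoid os R Ucd N.
have dV : d \notin [:: a; b; v; w].
  by apply: (rotatable_avoid os R Udc); rewrite same_edge_swap.
have aV : a \notin [:: c; d; v'; w'] by apply: (rotatable_avoid os R' Uab).
have bV : b \notin [:: c; d; v'; w'].
  by apply: (rotatable_avoid os R' Uba); rewrite same_edge_swap.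
have meet s1 p q t : optimal s1 -> uncolored s1 p t -> uncolored s1 q t -> p = q.
  move=> os1 U1 U2; apply: (optimal_matching os1 (a := t));
  by rewrite uncoloredC //; case: os1.
(* The first edge is moved one step and the second two: if [v1 = w2], the uncolored edges [a1 v1]
   and [v2 w2] would meet. *)
have step1 x1 y1 a1 b1 v1 w1 x2 y2 a2 b2 v2 w2 :
    rotatable s x1 y1 a1 b1 v1 w1 -> rotatable s x2 y2 a2 b2 v2 w2 ->
    ~~ same_edge a2 b2 a1 b1 ->
    a1 \notin [:: a2; b2; v2; w2] -> b1 \notin [:: a2; b2; v2; w2] ->
    a2 \notin [:: a1; b1; v1; w1] -> b2 \notin [:: a1; b1; v1; w1] ->
    v1 != v2 -> v1 != w2.
  move=> R1 R2 N12 a1V b1V a2V b2V v12.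
  have [s1 [cs1 le1 U1 F1]] := rotate1 cs R1.
  have F u : u \notin [:: a1; b1; v1; w1] -> u \notin [:: a1; b1; v1].
    by rewrite !inE !negb_or => /and4P[-> -> ->].
  have v2V : v2 \notin [:: a1; b1; v1].
    move: a1V b1V; rewrite !inE !negb_or => /and4P[_ _ A _] /and4P[_ _ B _].
    by rewrite !(eq_sym v2) A B v12.
  have R2' : rotatable s1 x2 y2 a2 b2 v2 w2.
    apply: (rotatable_transfer R2); first by case: R2 => U2 *; rewrite U1 U2 N12.
    by move=> i u; rewrite !inE => /or3P[]/eqP->; rewrite F1 // F.
  have [s2 [cs2 le2 U2 _]] := rotate2 cs1 R2'.
  have os2 : optimal s2 by apply: optimal_le os cs2 _; apply: leq_trans le1.
  apply: contraNneq (a1V) => E; rewrite !inE (meet s2 a1 v2 w2) ?eqxx ?orbT //.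
    rewrite U2 -E U1 /same_edge !eqxx /= orbT /=.
    move: a1V; rewrite !inE !negb_or => /and4P[A B _ _].
    by rewrite (negbTE A) (negbTE B).
  by rewrite U2 /same_edge !eqxx orbT.
(* Each edge is moved one step. The second move uses [rotate_step], because the colors at [v'] are
   not yet known to be intact. *)
have vv : v != v'.
  have [s1 [cs1 le1 U1 F1]] := rotate1 cs R.
  have F u : u \notin [:: a; b; v; w] -> u \notin [:: a; b; v].
    by rewrite !inE !negb_or => /and4P[-> -> ->].
  have U1cd : uncolored s1 c d by rewrite U1 Ucd N.
  have s1d : s1 y' d = d by rewrite F1 // F.
  have s1c : s1 y' c = v' by rewrite F1 // F.
  have s1c' : s1 y' c != c by rewrite s1c.
  have [s2 [cs2 le2 U2 _ _]] := rotate_step cs1 U1cd s1d s1c'.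
  have os2 : optimal s2 by apply: optimal_le os cs2 _; apply: leq_trans le1.
  apply: contraNneq (aV) => E; rewrite !inE (meet s2 a c v') ?eqxx ?orbT //.
    rewrite U2 s1c -E U1 /same_edge !eqxx /= orbT /=.
    move: aV; rewrite !inE !negb_or => /and4P[A B _ _].
    by rewrite (negbTE A) (negbTE B).
  by rewrite U2 s1c /same_edge !eqxx orbT.
have vw : v != w' by apply: (step1 _ _ _ _ _ _ _ _ _ _ _ _ R R').
have wv : w != v' by rewrite eq_sym; apply: (step1 _ _ _ _ _ _ _ _ _ _ _ _ R' R); rewrite // eq_sym.
(* Both edges are moved two steps; [w = w'] would then force [v = v']. *)
have ww : w != w'.
  have [s1 [cs1 le1 U1 F1]] := rotate2 cs R.
  have vV' : v' \notin [:: a; b; v; w].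
    move: aV bV; rewrite !inE !negb_or => /and4P[_ _ A _] /and4P[_ _ B _].
    by rewrite !(eq_sym v') A B vv wv.
  have R2' : rotatable s1 x' y' c d v' w'.
    apply: (rotatable_transfer R'); first by rewrite U1 Ucd N.
    by move=> i u; rewrite !inE => /or3P[]/eqP->; rewrite F1.
  have [s2 [cs2 le2 U2 _]] := rotate2 cs1 R2'.
  have os2 : optimal s2 by apply: optimal_le os cs2 _; apply: leq_trans le1.
  apply: contraNneq vv => E; apply/eqP; apply: (meet s2 _ _ w') => //.
    rewrite U2 -E U1 /same_edge !eqxx /= orbT /=.
    move: cV dV; rewrite !inE !negb_or => /and4P[_ _ A B] /and4P[_ _ C D].
    by rewrite (eq_sym v c) (negbTE A) (eq_sym v d) (negbTE C).
  by rewrite U2 /same_edge !eqxx orbT.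
rewrite -all_predC /= cV dV !inE /= !negb_or !(eq_sym v') !(eq_sym w') vv vw wv ww.
move: aV bV; rewrite !inE !negb_or => /and4P[_ _ -> ->] /and4P[_ _ -> ->].
by [].
Qed.

(** * Simultaneous rotation of all uncolored edges *)

(** Induction on [L]: by disjointness, rotating the first edge changes nothing at the vertices used
    by the others. *)
Lemma rotate_all (x y : T * T -> 'I_3) (v w : T * T -> T) (L : seq (T * T)) s :
  coloring s ->
  (forall e, e \in L -> rotatable s (x e) (y e) e.1 e.2 (v e) (w e)) ->
  uniq L ->
  (forall e f, e \in L -> f \in L -> e != f ->
     ~~ has [in [:: e.1; e.2; v e; w e]] [:: f.1; f.2; v f; w f]) ->
  exists2 s', coloring s' & forall p q, uncolored s' p q =
    uncolored s p q && ~~ has (fun e => same_edge p q e.1 e.2) L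
    || has (fun e => same_edge p q (v e) (w e)) L.
Proof.
elim: L s => [|e L IH] s cs R.
  by exists s => // p q; rewrite /= andbT orbF.
move=> /= /andP[NeL uL] disj.
have eL f : f \in L -> ~~ has [in [:: e.1; e.2; v e; w e]] [:: f.1; f.2; v f; w f].
  move=> fL; apply: disj; rewrite ?mem_head ?inE ?fL ?orbT //.
  by apply: contraNneq NeL => ->.
have [s1 [cs1 _ U1 F1]] := rotate2 cs (R e (mem_head _ _)).
have R1 f : f \in L -> rotatable s1 (x f) (y f) f.1 f.2 (v f) (w f).
  move=> fL; have := eL f fL; rewrite -all_predC /= !andbT => /and4P[N1 N2 N3 N4].
  have Rf : rotatable s (x f) (y f) f.1 f.2 (v f) (w f).
    by apply: R; rewrite inE fL orbT.
  have [Uf _ _ _ _] := Rf; apply: (rotatable_transfer Rf).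
    rewrite U1 Uf /=; apply/orP; left.
    by move: N1; apply: contraNN => /orP[]/andP[/eqP-> _]; rewrite !inE eqxx ?orbT.
  by move=> i u; rewrite !inE => /or3P[]/eqP->; rewrite F1.
have [s' cs' U'] : exists2 s', coloring s' & forall p q, uncolored s' p q =
    uncolored s1 p q && ~~ has (fun e => same_edge p q e.1 e.2) L
    || has (fun e => same_edge p q (v e) (w e)) L.
  apply: IH => // f g fL gL; apply: disj; rewrite inE ?fL ?gL orbT //.
exists s' => // p q; rewrite U' U1 /= negb_or.
case E: (same_edge p q (v e) (w e)); last by rewrite orbF -andbA.
rewrite orbT /= orbT; apply/orP; left; apply/hasPn => f fL.
have := eL f fL; rewrite -all_predC /= !andbT => /and4P[N1 N2 _ _].
apply/negP => F; case/orP: E F => /andP[/eqP-> /eqP->] /orP[]/andP[/eqP E1 /eqP E2].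
- by move: N1; rewrite -E1 !inE eqxx !orbT.
- by move: N2; rewrite -E1 !inE eqxx !orbT.
- by move: N1; rewrite -E1 !inE eqxx !orbT.
- by move: N2; rewrite -E1 !inE eqxx !orbT.
Qed.

(** Optimality makes [y] present at [a]. If [x] were missing at [s y a], one step would leave
    uncolored an edge both ends of which miss [x]. *)
Lemma optimal_rotatable s a b x y : optimal s -> uncolored s a b ->
  s x a = a -> s y b = b -> rotatable s x y a b (s y a) (s x (s y a)).
Proof.
move=> os Uab sa sb; have [cs _] := os.
have Uba : uncolored s b a by rewrite uncoloredC.
have va := optimal_missing os Uba sb.
split=> //; split=> //; apply/eqP => E.
have [s1 [cs1 le1 U1 _ [G1 H1]]] := rotate_step cs Uab sb va.
have os1 := optimal_le os cs1 le1.
have xy : x != y by apply: contraNneq va => E'; rewrite -{1}E' sa.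
have U1av : uncolored s1 a (s y a) by rewrite U1 /same_edge !eqxx orbT.
have s1a : s1 x a = a by rewrite G1.
by have := optimal_missing os1 U1av s1a; rewrite G1 // E eqxx.
Qed.

Lemma two_colorings : (forall a b c, r a b -> r b c -> r c a -> False) ->
  exists s s', [/\ coloring s, coloring s',
    forall u v, ~~ (uncolored s u v && uncolored s' u v) &
    forall u v w, uncolored s u v || uncolored s' u v ->
                  uncolored s u w || uncolored s' u w -> v = w].
Proof.
move=> tf; have [s os] := exists_optimal; have [cs _] := os.
(* At an end of an uncolored edge this is a missing color; the default [ord0] does not occur
   there. *)
pose X u := odflt ord0 [pick i | s i u == u].
have XP u v : uncolored s u v -> s (X u) u = u.
  move=> /(missing_color cs)[i /eqP si]; rewrite /X.
  by case: pickP => [j /eqP //|/(_ i)]; rewrite si.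
pose v (e : T * T) := s (X e.2) e.1; pose w e := s (X e.1) (v e).
(* Comparing ranks keeps one orientation of each uncolored edge. *)
pose L := [seq e <- enum {: T * T} | uncolored s e.1 e.2 && (enum_rank e.1 < enum_rank e.2)].
have LU e : e \in L -> uncolored s e.1 e.2 by rewrite mem_filter => /andP[/andP[]].
have LR e : e \in L -> rotatable s (X e.1) (X e.2) e.1 e.2 (v e) (w e).
  move=> /LU Ue; apply: optimal_rotatable => //; first exact: XP Ue.
  by apply: (XP _ e.1); rewrite uncoloredC.
have Lne e f : e \in L -> f \in L -> e != f -> ~~ same_edge f.1 f.2 e.1 e.2.
  case: e f => [a b] [c d]; rewrite !mem_filter => /andP[/andP[_ /= ab] _] /andP[/andP[_ /= cd] _] N.
  apply/negP => /orP[]/andP[/eqP Ec /eqP Ed]; first by rewrite Ec Ed eqxx in N.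
  by move: ab; rewrite -Ec -Ed ltnNge ltnW.
have LD e f : e \in L -> f \in L -> e != f ->
    ~~ has [in [:: e.1; e.2; v e; w e]] [:: f.1; f.2; v f; w f].
  by move=> eL fL N; apply: rotatable_disjoint (LR _ eL) (LR _ fL) (Lne _ _ eL fL N).
have LI e f p : e \in L -> f \in L -> p \in [:: e.1; e.2; v e; w e] ->
    p \in [:: f.1; f.2; v f; w f] -> e = f.
  move=> eL fL pe pf; apply/eqP/negPn/negP => N.
  by move: (LD _ _ eL fL N) => /hasPn/(_ p pf) /=; rewrite pe.
have [s' cs' U'] := rotate_all cs LR (filter_uniq _ (enum_uniq _)) LD.
have Lcov p q : uncolored s p q -> has (fun e => same_edge p q e.1 e.2) L.
  move=> Upq; apply/hasP; have pq : p != q.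
    by apply: contraTneq Upq => ->; rewrite /uncolored rI.
  have [le|le] := ltnP (enum_rank p) (enum_rank q).
    by exists (p, q); rewrite /same_edge ?eqxx // mem_filter Upq le mem_enum.
  exists (q, p); rewrite /same_edge ?eqxx ?orbT // mem_filter mem_enum /= andbT.
  rewrite uncoloredC // Upq /= ltn_neqAle le andbT.
  by rewrite (inj_eq val_inj) (inj_eq enum_rank_inj) eq_sym.
have {}U' p q : uncolored s' p q = has (fun e => same_edge p q (v e) (w e)) L.
  rewrite U'; case E: (uncolored s p q) => //=.
  by rewrite Lcov.
have UL p q : uncolored s p q -> exists2 e, e \in L & same_edge p q e.1 e.2.
  by move=> /Lcov/hasP.
have UL' p q : uncolored s' p q -> exists2 e, e \in L & same_edge p q (v e) (w e).
  by rewrite U' => /hasP.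
have Vl e p q : same_edge p q e.1 e.2 -> p \in [:: e.1; e.2; v e; w e].
  by case/orP => /andP[/eqP-> _]; rewrite !inE eqxx ?orbT.
have Vr e p q : same_edge p q (v e) (w e) -> p \in [:: e.1; e.2; v e; w e].
  by case/orP => /andP[/eqP-> _]; rewrite !inE eqxx ?orbT.
have both p q t : uncolored s p q -> uncolored s' p t -> False.
  move=> /UL[e eL Ee] /UL'[f fL Ef].
  have Eef := LI _ _ _ eL fL (Vl _ _ _ Ee) (Vr _ _ _ Ef); subst f.
  have [/andP[rab /forallP Nab] [sa sb] Ev Ew [va wv]] := LR e eL.
  have rav : r e.1 (v e) by rewrite -Ev (coloring_neq cs) // Ev.
  have rvw : r (v e) (w e) by rewrite -Ew (coloring_neq cs) // Ew.
  have vb : v e != e.2 by rewrite -Ev.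
  have wa : w e != e.1.
    have sK : involutive (s (X e.1)) by case: cs.
    by apply: contraNneq va => E; rewrite -(sK (v e)) Ew E sa.
  (* Triangle-freeness enters here: [w e = e.2] would close the triangle [e.1], [v e], [e.2]. *)
  have wb : w e != e.2.
    apply/eqP => E; apply: (tf e.1 (v e) (w e)); rewrite // E rS //.
  by case/orP: Ee => /andP[/eqP Ep _]; case/orP: Ef => /andP[/eqP Ep' _];
    move: va vb wa wb; rewrite -Ep -Ep' eqxx.
exists s, s'; split=> //.
  by move=> p q; apply/negP => /andP[U1 U2]; apply: both U1 U2.
move=> p q t /orP[U1|U1] /orP[U2|U2].
- exact: optimal_matching os U1 U2.
- by case: (both _ _ _ U1 U2).
- by case: (both _ _ _ U2 U1).
have [e eL Ee] := UL' _ _ U1; have [f fL Ef] := UL' _ _ U2.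
have Eef := LI _ _ _ eL fL (Vr _ _ _ Ee) (Vr _ _ _ Ef); subst f.
have [_ _ _ _ [_ wv]] := LR e eL.
case/orP: Ee => /andP[/eqP Ep /eqP ->]; case/orP: Ef => /andP[/eqP Ep' /eqP ->] //;
  by rewrite -Ep -Ep' eqxx in wv.
Qed.

End PartialColoring.

(** * Seven colors for subcubic graphs *)

(** The set [g u v] stands for the colors of the two incidences on the edge [uv]; values of [g]
    outside [r] are free. *)
Definition pair_coloring (T : eqType) (C : finType) (r : rel T) (g : T -> T -> {set C}) : Prop :=
  [/\ forall u v, r u v -> g u v = g v u,
      forall u v, r u v -> #|g u v| = 2 &
      forall u v w, r u v -> r u w -> v != w -> [disjoint g u v & g u w]].

Definition triangle_free (T : finType) (r : rel T) : Prop :=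
  forall a b c, r a b -> r b c -> r c a -> False.

(* Three colors come from each of two partial 3-edge-colorings, and the seventh
   is given to the edges left uncolored by one of them. *)
Definition seven : finType := ('I_3 + 'I_3 + unit)%type.

Lemma card_seven : #|{: seven}| = 7.
Proof. by rewrite !card_sum !card_ord card_unit. Qed.

Lemma triangle_free_seven (T : finType) (r : rel T) :
  symmetric r -> irreflexive r -> subcubic r -> triangle_free r ->
  exists g : T -> T -> {set seven}, pair_coloring r g.
Proof.
move=> rS rI r3 tf.
have [s [s' [cs cs' dis mat]]] := two_colorings rS rI r3 tf.
pose U u v := uncolored r s u v || uncolored r s' u v.
pose g u v : {set seven} := [set k | match k with
  | inl (inl i) => s i u == v | inl (inr i) => s' i u == v | inr _ => U u v end].
have US u v : U u v = U v u.
  by rewrite /U (uncoloredC rS cs) (uncoloredC rS cs').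
have eqS t u v i : coloring r t -> (t i u == v) = (t i v == u).
  by case=> tK _ _; apply/eqP/eqP => <-; rewrite tK.
exists g; split=> [u v ruv|u v ruv|u v w ruv ruw vw].
- apply/setP => -[[i|i]|[]]; rewrite !inE.
  + exact: eqS cs.
  + exact: eqS cs'.
  + exact: US.
- have uv : u != v by apply: contraTneq ruv => ->; rewrite rI.
  have one t : coloring r t -> ~~ uncolored r t u v ->
      exists2 i, t i u = v & forall j, (t j u == v) = (j == i).
    move=> ct /(uncoloredPn _ ruv)[i Ei]; exists i => // j.
    apply/eqP/eqP => [Ej|-> //]; case: ct => _ _ tI.
    by apply: (tI j i u); rewrite Ej // eq_sym.
  have none t : uncolored r t u v -> forall j, (t j u == v) = false.
    by move=> /andP[_ /forallP N] j; apply/negbTE.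
  have := dis u v; case E: (uncolored r s u v); case E': (uncolored r s' u v) => //= _.
  + have [i _ Hi] := one _ cs' (negbT E').
    suff -> : g u v = [set inl (inr i); inr tt] by rewrite cards2.
    by apply/setP => -[[j|j]|[]]; rewrite !inE ?(none _ E) // ?Hi /U ?E ?orbF.
  + have [i _ Hi] := one _ cs (negbT E).
    suff -> : g u v = [set inl (inl i); inr tt] by rewrite cards2.
    by apply/setP => -[[j|j]|[]]; rewrite !inE ?(none _ E') // ?Hi /U ?E' ?orbT ?orbF.
  + have [i _ Hi] := one _ cs (negbT E); have [i' _ Hi'] := one _ cs' (negbT E').
    suff -> : g u v = [set inl (inl i); inl (inr i')] by rewrite cards2.
    by apply/setP => -[[j|j]|[]]; rewrite !inE ?Hi ?Hi' /U ?E ?E' ?orbF.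
- rewrite -setI_eq0; apply/eqP/setP => -[[i|i]|[]]; rewrite !inE;
    apply/negbTE/negP => /andP[].
  + by move=> /eqP-> /eqP E; rewrite E eqxx in vw.
  + by move=> /eqP-> /eqP E; rewrite E eqxx in vw.
  + by move=> Uuv Uuw; rewrite (mat _ _ _ Uuv Uuw) eqxx in vw.
Qed.

(** * Coloring a diamond *)

Lemma disjoint2 (C : finType) (x y z t : C) :
  x != z -> x != t -> y != z -> y != t -> [disjoint [set x; y] & [set z; t]].
Proof.
move=> xz xt yz yt; rewrite -setI_eq0; apply/eqP/setP => k; rewrite !inE.
by apply/negbTE/negP => /andP[/orP[]/eqP-> /orP[]/eqP E]; move: xz xt yz yt;
  rewrite E eqxx.
Qed.

(* [AB], ..., [BD] color the edges of a diamond, [P] and [Q] being the colors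
   already present at its vertices of degree 2. *)
Lemma diamond_palette (C : finType) (P Q : {set C}) :
  #|C| = 7 -> #|P| <= 2 -> #|Q| <= 2 ->
  exists AB AC BC AD BD : {set C},
    [/\ [/\ #|AB| = 2, #|AC| = 2, #|BC| = 2, #|AD| = 2 & #|BD| = 2],
        [/\ [disjoint AB & AC], [disjoint AB & AD] & [disjoint AC & AD]],
        [/\ [disjoint AB & BC], [disjoint AB & BD] & [disjoint BC & BD]],
        [/\ [disjoint AC & BC], [disjoint AC & P] & [disjoint BC & P]] &
        [/\ [disjoint AD & BD], [disjoint AD & Q] & [disjoint BD & Q]]].
Proof.
move=> C7 P2 Q2.
have ext (S : {set C}) : #|S| <= 2 -> exists2 S' : {set C}, S \subset S' & #|S'| = 2.
  move=> S2; have [||S' [? _ ?]] := @subset_extend C S setT 2; last by exists S'.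
  - exact: subsetT.
  - by rewrite S2 cardsT C7.
have [P' PP' {}P2] := ext P P2; have [Q' QQ' {}Q2] := ext Q Q2.
suff [AB [AC [BC [AD [BD [? ? ? [? d1 d2] [? d3 d4]]]]]]] :
    exists AB AC BC AD BD : {set C},
    [/\ [/\ #|AB| = 2, #|AC| = 2, #|BC| = 2, #|AD| = 2 & #|BD| = 2],
        [/\ [disjoint AB & AC], [disjoint AB & AD] & [disjoint AC & AD]],
        [/\ [disjoint AB & BC], [disjoint AB & BD] & [disjoint BC & BD]],
        [/\ [disjoint AC & BC], [disjoint AC & P'] & [disjoint BC & P']] &
        [/\ [disjoint AD & BD], [disjoint AD & Q'] & [disjoint BD & Q']]].
  exists AB, AC, BC, AD, BD; split=> //; split=> //.
  - exact: disjointWr PP' d1.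
  - exact: disjointWr PP' d2.
  - exact: disjointWr QQ' d3.
  - exact: disjointWr QQ' d4.
have cardPQ : #|P' :|: Q'| + #|P' :&: Q'| = 4 by rewrite cardsUI P2 Q2.
have cardW : #|~: (P' :|: Q')| + #|P' :|: Q'| = 7 by rewrite addnC cardsC C7.
(* If [P'] and [Q'] are disjoint, three colors [x], [y], [z] lie outside both. Then [AC] takes [x]
   and a color of [Q'], [BD] takes [x] and a color of [P'], [AB] takes the other color of each, and
   [BC] and [AD] share [y] and [z]. *)
have [dPQ|dPQ] := boolP [disjoint P' & Q'].
  have PQ0 : #|P' :&: Q'| = 0 by apply/eqP; rewrite cards_eq0 setI_eq0.
  have /card_gt0P[z zW] : 0 < #|~: (P' :|: Q')| by lia.
  have /eqP/cards2P[x [y [xy Exy]]] : #|(~: (P' :|: Q')) :\ z| = 2.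
    by have := cardsD1 z (~: (P' :|: Q')); rewrite zW; lia.
  have /eqP/cards2P[p1 [p2 [p12 EP]]] := P2; have /eqP/cards2P[q1 [q2 [q12 EQ]]] := Q2.
  have xW : x \in (~: (P' :|: Q')) :\ z by rewrite Exy !inE eqxx.
  have yW : y \in (~: (P' :|: Q')) :\ z by rewrite Exy !inE eqxx orbT.
  move: xW yW zW; rewrite EP EQ !inE !negb_or -!andbA.
  case/and5P => xz xp1 xp2 xq1 xq2 /and5P[yz yp1 yp2 yq1 yq2] /and4P[zp1 zp2 zq1 zq2].
  have pq p q : p \in P' -> q \in Q' -> p != q.
    by move=> pP qQ; apply: contraTneq pP => ->; rewrite (disjointFl dPQ).
  have p1q1 : p1 != q1 by apply: pq; rewrite ?EP ?EQ !inE eqxx ?orbT.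
  have p1q2 : p1 != q2 by apply: pq; rewrite ?EP ?EQ !inE eqxx ?orbT.
  have p2q1 : p2 != q1 by apply: pq; rewrite ?EP ?EQ !inE eqxx ?orbT.
  have p2q2 : p2 != q2 by apply: pq; rewrite ?EP ?EQ !inE eqxx ?orbT.
  exists [set p1; q1], [set q2; x], [set y; z], [set y; z], [set p2; x].
  rewrite !cards2 (eq_sym q2 x) (eq_sym p2 x) p1q1 xq2 yz xp2.
  by do !split=> //; apply: disjoint2; rewrite // eq_sym.
(* If they meet, at least four colors lie outside, enough for disjoint pairs [X] and [Y], each used
   on two opposite edges. [AB] only has to avoid these, so [Z] may use colors of [P'] and [Q']. *)
have PQ1 : 0 < #|P' :&: Q'| by rewrite card_gt0 setI_eq0.
have [||X [_ XW X2]] := @subset_extend C set0 (~: (P' :|: Q')) 2.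
- exact: sub0set.
- by rewrite cards0; lia.
have [||Y [_ YW Y2]] := @subset_extend C set0 (~: (P' :|: Q') :\: X) 2.
- exact: sub0set.
- by rewrite cards0 cardsD (setIidPr XW) X2; lia.
have [||Z [_ ZW Z2]] := @subset_extend C set0 (~: (X :|: Y)) 2.
- exact: sub0set.
- by have [] := leq_card_setU X Y; have := cardsC (X :|: Y); rewrite cards0 C7 X2 Y2; lia.
have dXY : [disjoint X & Y].
  by rewrite disjoint_sym disjoints_subset (subset_trans YW) // subDset setUCr subsetT.
have dZ : [disjoint Z & X] && [disjoint Z & Y].
  by rewrite !disjoints_subset -subsetI -setCU.
have dW (V : {set C}) : V \subset ~: (P' :|: Q') -> [disjoint V & P'] && [disjoint V & Q'].
  by rewrite !disjoints_subset -subsetI -setCU.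
have /andP[XP XQ] := dW _ XW.
have /andP[YP YQ] := dW _ (subset_trans YW (subsetDl _ _)).
case/andP: dZ => ZX ZY.
by exists Z, X, Y, Y, X; split; split=> //; rewrite disjoint_sym.
Qed.

Lemma subcubic_third (T : finType) (r : rel T) x y z t t' : subcubic r ->
  r x y -> r x z -> y != z -> r x t -> r x t' ->
  t \notin [:: y; z] -> t' \notin [:: y; z] -> t = t'.
Proof.
move=> r3 xy xz yz xt xt' tN tN'; apply/eqP/negPn/negP => tt.
have := r3 x; rewrite leqNgt => /negP; apply.
have U4 : uniq [:: t; t'; y; z].
  move: tN tN'; rewrite /= !inE !negb_or => /andP[-> ->] /andP[-> ->].
  by rewrite tt yz.
rewrite -[4]/(size [:: t; t'; y; z]) -(card_uniqP U4).
apply: subset_leq_card; apply/fintype.subsetP => u; rewrite !inE.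
by case/or4P => /eqP->.
Qed.

Lemma card_bigcup_unique (T C : finType) (p : pred T) (F : T -> {set C}) k :
  (forall t t', p t -> p t' -> t = t') -> (forall t, p t -> #|F t| <= k) ->
  #|\bigcup_(t | p t) F t| <= k.
Proof.
move=> pU Fk; have [t pt|p0] := pickP p; last by rewrite big_pred0 ?cards0.
rewrite (big_pred1 t) ?Fk // => t'; apply/idP/eqP => [pt'|-> //]; exact: pU.
Qed.

(** The edges at [a] and [b] are colored last. Each of [c] and [d] has at most one other edge, whose
    pair is passed to [diamond_palette]. *)
Lemma extend_diamond (T C : finType) (r : rel T) a b c d :
  #|C| = 7 -> symmetric r -> irreflexive r -> subcubic r ->
  r a b -> r a c -> r b c -> r a d -> r b d -> c != d ->
  (exists g : T -> T -> {set C},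
     pair_coloring (fun u v => [&& r u v, u \notin [:: a; b] & v \notin [:: a; b]]) g) ->
  exists g : T -> T -> {set C}, pair_coloring r g.
Proof.
move=> C7 rS rI r3 ab ac bc ad bd cd.
pose r' u v := [&& r u v, u \notin [:: a; b] & v \notin [:: a; b]].
rewrite -/r' => -[g [gS g2 gD]].
have ne u v : r u v -> u != v by move=> ruv; apply: contraTneq ruv => ->; rewrite rI.
have ba : r b a by rewrite rS.
have dc : d != c by rewrite eq_sym.
have Na t : r a t -> t \in [:: b; c; d].
  move=> rat; have [N|] := boolP (t \in [:: b; c]); last move=> N.
    by move: N; rewrite !inE => /orP[]->; rewrite ?orbT.
  rewrite (subcubic_third r3 ab ac (ne _ _ bc) rat ad N) ?inE ?eqxx ?orbT //.
  by rewrite negb_or dc andbT eq_sym (ne _ _ bd).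
have Nb t : r b t -> t \in [:: a; c; d].
  move=> rbt; have [N|] := boolP (t \in [:: a; c]); last move=> N.
    by move: N; rewrite !inE => /orP[]->; rewrite ?orbT.
  rewrite (subcubic_third r3 ba bc (ne _ _ ac) rbt bd N) ?inE ?eqxx ?orbT //.
  by rewrite negb_or dc andbT eq_sym (ne _ _ ad).
pose S u := \bigcup_(t | r' u t) g u t.
have S2 u : r a u -> r b u -> #|S u| <= 2.
  move=> au bu; apply: card_bigcup_unique => [t t'|t]; last by move=> /g2->.
  move=> /and3P[ut _ tN] /and3P[ut' _ tN'].
  by apply: subcubic_third r3 _ _ (ne _ _ ab) ut ut' tN tN'; rewrite rS.
have [AB [AC [BC [AD [BD [[cAB cAC cBC cAD cBD]]]]]]] :=
  diamond_palette C7 (S2 c ac bc) (S2 d ad bd).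
move=> [dABAC dABAD dACAD] [dABBC dABBD dBCBD] [dACBC dACP dBCP] [dADBD dADQ dBDQ].
(* These are the pairs for the edges from [a] and from [b] to [v]; the last branch of each is meant
   for [d]. *)
pose A_ v := if v == b then AB else if v == c then AC else AD.
pose B_ v := if v == c then BC else BD.
pose h u v := if u == a then A_ v else if v == a then A_ u
              else if u == b then B_ v else if v == b then B_ u else g u v.
have cb : (c == b) = false by apply/negbTE; rewrite eq_sym ne.
have db : (d == b) = false by apply/negbTE; rewrite eq_sym ne.
have bb : (b == a) = false by apply/negbTE; rewrite ne.
have caF : (c == a) = false by apply/negbTE; rewrite eq_sym ne.
have daF : (d == a) = false by apply/negbTE; rewrite eq_sym ne.
have Ab : A_ b = AB by rewrite /A_ eqxx.
have Ac : A_ c = AC by rewrite /A_ cb eqxx.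
have Ad : A_ d = AD by rewrite /A_ db (negbTE dc).
have Bc : B_ c = BC by rewrite /B_ eqxx.
have Bd : B_ d = BD by rewrite /B_ (negbTE dc).
have cd_cases u : r a u \/ r b u -> u \notin [:: a; b] -> u \in [:: c; d].
  rewrite !inE !negb_or => H /andP[ua ub].
  by case: H => [/Na|/Nb]; rewrite !inE ?(negbTE ua) ?(negbTE ub).
exists h; split=> [u v uv|u v uv|u v w uv uw vw].
- rewrite /h; case: (eqVneq u a) => [Eu|ua]; case: (eqVneq v a) => [Ev|va]; rewrite ?Eu ?Ev //.
  case: (eqVneq u b) => [Eu|ub]; case: (eqVneq v b) => [Ev|vb]; rewrite ?Eu ?Ev //.
  by apply: gS; rewrite /r' uv !inE (negbTE ua) (negbTE va) (negbTE ub) (negbTE vb).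
- have A2 t : #|A_ t| = 2 by rewrite /A_; case: ifP => // _; case: ifP.
  have B2 t : #|B_ t| = 2 by rewrite /B_; case: ifP.
  rewrite /h; case: (eqVneq u a) => [//|ua]; case: (eqVneq v a) => [//|va].
  case: (eqVneq u b) => [//|ub]; case: (eqVneq v b) => [//|vb].
  by apply: g2; rewrite /r' uv !inE (negbTE ua) (negbTE va) (negbTE ub) (negbTE vb).
have [Eu|ua] := eqVneq u a.
  rewrite /h Eu eqxx; move: uv uw; rewrite Eu => /Na + /Na; rewrite !inE.
  by case/or3P => /eqP Ev /or3P[]/eqP Ew; move: vw; rewrite Ev Ew ?eqxx //;
    rewrite ?Ab ?Ac ?Ad // disjoint_sym.
have [Eu|ub] := eqVneq u b.
  have hb t : r b t -> h b t = if t == a then AB else B_ t.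
    by move=> bt; rewrite /h bb eqxx Ab.
  rewrite Eu in uv uw *; rewrite !hb //.
  move: (Nb _ uv) (Nb _ uw); rewrite !inE.
  by case/or3P => /eqP Ev /or3P[]/eqP Ew; move: vw; rewrite Ev Ew ?eqxx //;
    rewrite ?caF ?daF ?Bc ?Bd // disjoint_sym.
have hu t : h u t = if t == a then A_ u else if t == b then B_ u else g u t.
  by rewrite /h (negbTE ua) (negbTE ub).
have uN : u \notin [:: a; b] by rewrite !inE (negbTE ua) (negbTE ub).
have ru t : r u t -> t != a -> t != b -> r' u t.
  by move=> ut ta tb; rewrite /r' ut uN !inE (negbTE ta) (negbTE tb).
have dAB : u \in [:: c; d] -> [disjoint A_ u & B_ u].
  by rewrite !inE => /orP[]/eqP->; rewrite ?Ac ?Bc ?Ad ?Bd.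
have sup t : r' u t -> g u t \subset S u by move=> ut; apply: bigcup_sup.
have dAS : u \in [:: c; d] -> [disjoint A_ u & S u].
  by rewrite !inE => /orP[]/eqP->; rewrite ?Ac ?Ad.
have dBS : u \in [:: c; d] -> [disjoint B_ u & S u].
  by rewrite !inE => /orP[]/eqP->; rewrite ?Bc ?Bd.
have ucd t : r u t -> (t == a) || (t == b) -> u \in [:: c; d].
  by rewrite rS => + /orP[]/eqP E; rewrite E => ?; apply: cd_cases => //; [left|right].
rewrite !hu; move: (ucd v uv) (ucd w uw) (ru v uv) (ru w uw).
case: (eqVneq v a) => [Ev|va]; case: (eqVneq w a) => [Ew|wa].
- by rewrite Ev Ew eqxx in vw.
- case: (eqVneq w b) => [_|wb]; first by move=> /(_ isT)/dAB.
  by move=> /(_ isT)/dAS d1 _ _ /(_ isT isT)/sup s1; apply: disjointWr s1 d1.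
- case: (eqVneq v b) => [_|vb]; first by rewrite disjoint_sym => /(_ isT)/dAB.
  by move=> _ /(_ isT)/dAS d1 /(_ isT isT)/sup s1 _; rewrite disjoint_sym; apply: disjointWr s1 d1.
case: (eqVneq v b) => [Ev|vb]; case: (eqVneq w b) => [Ew|wb].
- by rewrite Ev Ew eqxx in vw.
- by move=> /(_ isT)/dBS d1 _ _ /(_ isT isT)/sup s1; apply: disjointWr s1 d1.
- by move=> _ /(_ isT)/dBS d1 /(_ isT isT)/sup s1 _; rewrite disjoint_sym; apply: disjointWr s1 d1.
- by move=> _ _ /(_ isT isT) uv' /(_ isT isT) uw'; apply: gD.
Qed.

(** * Contracting a triangle *)

(** The vertex type is kept: for a triangle, [b] and [c] become isolated, and [u != v] drops the
    loops at [a]. *)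
Definition contract (T : finType) (r : rel T) (a b c : T) : rel T :=
  let f u := if u \in [:: b; c] then a else u in
  fun u v => (u != v) && [exists p, exists q, [&& r p q, f p == u & f q == v]].

(* In a triangle [a b c] whose outgoing edges are colored from [A], [B] and [D],
   an edge receives the colors reserved for the vertex opposite to it. *)
Definition opposite (T C : finType) (a b : T) (A B D : {set C}) (u v : T) : {set C} :=
  if a \notin [:: u; v] then A else if b \notin [:: u; v] then B else D.

Section Opposite.
Variables (T C : finType) (a b c : T) (A B D : {set C}).
Hypotheses (ab : a != b) (bc : b != c) (ac : a != c).
Hypotheses (dBA : [disjoint B & A]) (dDA : [disjoint D & A]) (dDB : [disjoint D & B]).

Let neq := (negbTE ab, negbTE bc, negbTE ac, eq_sym b a, eq_sym c a, eq_sym c b, eqxx).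

Let disj : [/\ [disjoint A & B], [disjoint A & D] & [disjoint B & D]].
Proof. by split; rewrite disjoint_sym. Qed.

(** An edge at [u] is opposite to a vertex other than [u], so it avoids the set reserved for [u],
    hence the colors leaving the triangle there. *)
Lemma opposite_disjoint u v : u \in [:: a; b; c] -> v \in [:: a; b; c] -> u != v ->
  [disjoint opposite a b A B D u v & if u == a then A else if u == b then B else D].
Proof.
have [dAB dAD dBD] := disj.
rewrite !inE => /or3P[]/eqP-> /or3P[]/eqP->; rewrite /opposite !inE ?neq //.
Qed.

Lemma opposite_disjoint2 u v w :
  u \in [:: a; b; c] -> v \in [:: a; b; c] -> w \in [:: a; b; c] ->
  u != v -> u != w -> v != w ->
  [disjoint opposite a b A B D u v & opposite a b A B D u w].
Proof.
have [dAB dAD dBD] := disj.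
by rewrite !inE => /or3P[]/eqP-> /or3P[]/eqP-> /or3P[]/eqP->; rewrite /opposite !inE ?neq.
Qed.
End Opposite.

(** After contraction the edges leaving the triangle, at most three, meet at [a], and the last
    hypothesis keeps them distinct. Their pairs are thus disjoint; completed to disjoint pairs [A],
    [B], [D], they serve again on the opposite edges. *)
Lemma extend_triangle (T C : finType) (r : rel T) a b c :
  #|C| = 7 -> symmetric r -> irreflexive r -> subcubic r ->
  r a b -> r b c -> r c a ->
  (forall t x y, t \notin [:: a; b; c] -> x \in [:: a; b; c] -> y \in [:: a; b; c] ->
     r x t -> r y t -> x = y) ->
  subcubic (contract r a b c) /\
  ((exists g : T -> T -> {set C}, pair_coloring (contract r a b c) g) ->
   exists g : T -> T -> {set C}, pair_coloring r g).
Proof.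
move=> C7 rS rI r3 ab bc ca nd.
set tri := [:: a; b; c].
pose f u := if u \in [:: b; c] then a else u.
set r' := contract r a b c.
have ne u v : r u v -> u != v by move=> ruv; apply: contraTneq ruv => ->; rewrite rI.
have [[nab nbc] nca] := (ne _ _ ab, ne _ _ bc, ne _ _ ca).
have nac : a != c by rewrite eq_sym.
have [ba cb ac] : [/\ r b a, r c b & r a c] by split; rewrite rS.
have fa u : u \in tri -> f u = a.
  by rewrite /f !inE => /orP[/eqP->|->] //; case: ifP.
have fo u : u \notin tri -> f u = u.
  by rewrite /f !inE negb_or => /andP[_ /negbTE->].
have fne u v : u != v -> ~~ ((u \in tri) && (v \in tri)) -> f u != f v.
  move=> uv; case: (boolP (u \in tri)) => ut; case: (boolP (v \in tri)) => vt //= _.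
  - by rewrite (fa u) // fo //; apply: contraNneq vt => <-; rewrite inE eqxx.
  - by rewrite (fa v) // fo //; apply: contraNneq ut => ->; rewrite inE eqxx.
  - by rewrite !fo.
have r'f u v : r u v -> ~~ ((u \in tri) && (v \in tri)) -> r' (f u) (f v).
  move=> uv N; rewrite /r' /contract fne ?ne //=.
  by apply/existsP; exists u; apply/existsP; exists v; rewrite uv !eqxx.
have outer x t t' : x \in tri -> r x t -> r x t' -> t \notin tri -> t' \notin tri -> t = t'.
  move=> xt rt rt'; rewrite !inE !negb_or => /and3P[ta tb tc] /and3P[ta' tb' tc'].
  move: xt rt rt'; rewrite !inE => /or3P[]/eqP-> rt rt'.
  - by apply: (subcubic_third r3 ab ac nbc); rewrite // !inE negb_or ?tb ?tb'.
  - by apply: (subcubic_third r3 ba bc nac); rewrite // !inE negb_or ?ta ?ta'.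
  - by apply: (subcubic_third r3 ca cb nab); rewrite // !inE negb_or ?ta ?ta'.
have r'P u v : r' u v -> u != v /\ exists p q, [/\ r p q, f p = u & f q = v].
  move=> /andP[uv /existsP[p /existsP[q /and3P[pq /eqP fp /eqP fq]]]].
  by split=> //; exists p, q.
pose O x := \bigcup_(t | r x t && (t \notin tri)) [set t].
have O1 x : x \in tri -> #|O x| <= 1.
  move=> xt; apply: card_bigcup_unique => [t t' /andP[rt tN] /andP[rt' tN']|t _].
    exact: outer rt rt' tN tN'.
  by rewrite cards1.
split.
  move=> u; have [ut|ut] := boolP (u \in tri).
    apply: (@leq_trans #|O a :|: O b :|: O c|).
      apply: subset_leq_card; apply/fintype.subsetP => v; rewrite inE.
      move=> /r'P[uv [p [q [pq fp fq]]]].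
      have qN : q \notin tri.
        apply: contraNN uv => qt; rewrite -fq fa //; move: ut; rewrite -fp.
        by case: (boolP (p \in tri)) => pt; [rewrite fa|rewrite fo // (negbTE pt)].
      have pt : p \in tri.
        by apply: contraLR ut => pt; rewrite -fp fo.
      have qO : q \in O p by apply/bigcupP; exists q; rewrite ?set11 // pq.
      rewrite -fq fo // !in_setU; move: pt qO.
      by rewrite !inE => /or3P[]/eqP-> ->; rewrite ?orbT.
    have [l1 _] := leq_card_setU (O a :|: O b) (O c).
    have [l2 _] := leq_card_setU (O a) (O b).
    have := (O1 a, O1 b, O1 c); rewrite /tri !inE !eqxx !orbT => -[[/(_ isT) A /(_ isT) B] /(_ isT) D].
    exact: leq_trans l1 (leq_add (leq_trans l2 (leq_add A B)) D).
  apply: leq_trans (r3 u).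
  apply: (@leq_trans #|f @: [set v | r u v]|); last exact: leq_imset_card.
  apply: subset_leq_card; apply/fintype.subsetP => v; rewrite inE.
  move=> /r'P[uv [p [q [pq fp fq]]]].
  have pN : p \notin tri.
    by apply: contraNN ut => pt; rewrite -fp fa // inE eqxx.
  by apply/imsetP; exists q => //; rewrite inE -fp fo.
case=> g [gS g2 gD].
pose S x := \bigcup_(t | r x t && (t \notin tri)) g a t.
have r'o x t : x \in tri -> r x t -> t \notin tri -> r' a t.
  by move=> xt rt tN; rewrite -(fa x) // -(fo t) //; apply: r'f; rewrite // negb_and tN orbT.
have S2 x : x \in tri -> #|S x| <= 2.
  move=> xt; apply: card_bigcup_unique => [t t' /andP[rt tN] /andP[rt' tN']|t /andP[rt tN]].
    exact: outer rt rt' tN tN'.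
  by rewrite g2 //; apply: r'o rt tN.
have dS x y : x \in tri -> y \in tri -> x != y -> [disjoint S x & S y].
  move=> xt yt xy; apply/bigcup_disjointP => t /andP[rt tN].
  rewrite disjoint_sym; apply/bigcup_disjointP => t' /andP[rt' tN'].
  apply: gD; [exact: r'o rt tN|exact: r'o rt' tN'|].
  by apply: contraNneq xy => E; apply/eqP; apply: (nd t); rewrite // E.
have [atri btri ctri] : [/\ a \in tri, b \in tri & c \in tri].
  by rewrite !inE !eqxx !orbT.
(* [V] will be a union of two sets of at most two colors, so at least three of the seven remain. *)
have ext (X V : {set C}) : #|X| <= 2 -> #|V| <= 4 -> [disjoint X & V] ->
    exists X' : {set C}, [/\ X \subset X', #|X'| = 2 & [disjoint X' & V]].
  move=> X2 V4 dXV; have [||X' [? ? ?]] := @subset_extend C X (~: V) 2.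
  - by rewrite -disjoints_subset.
  - rewrite X2 -(leq_add2l #|V|) cardsC C7.
    exact: leq_trans (leq_add V4 (leqnn 2)) _.
  - by exists X'; rewrite disjoints_subset.
have U4 (X Y : {set C}) : #|X| <= 2 -> #|Y| <= 2 -> #|X :|: Y| <= 4.
  by move=> X2 Y2; have [le _] := leq_card_setU X Y; exact: leq_trans le (leq_add X2 Y2).
have dU (X Y Z : {set C}) : [disjoint X & Y] -> [disjoint X & Z] -> [disjoint X & Y :|: Z].
  by rewrite !(disjoint_sym X) !disjoints_subset subUset => -> ->.
have [A [SA A2 dA]] := ext (S a) (S b :|: S c) (S2 a atri) (U4 _ _ (S2 b btri) (S2 c ctri))
  (dU _ _ _ (dS a b atri btri nab) (dS a c atri ctri nac)).
have dAb : [disjoint A & S b] by apply: disjointWr dA; apply: subsetUl.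
have dAc : [disjoint A & S c] by apply: disjointWr dA; apply: subsetUr.
have [||B [SB B2 dB]] := ext (S b) (A :|: S c) (S2 b btri).
- by apply: U4; rewrite ?A2 ?S2.
- by apply: dU; [rewrite disjoint_sym|apply: dS].
have dBA : [disjoint B & A] by apply: disjointWr dB; apply: subsetUl.
have dBc : [disjoint B & S c] by apply: disjointWr dB; apply: subsetUr.
have [||D [SD D2 dD]] := ext (S c) (A :|: B) (S2 c ctri).
- by apply: U4; rewrite ?A2 ?B2.
- by apply: dU; rewrite disjoint_sym.
have dDA : [disjoint D & A] by apply: disjointWr dD; apply: subsetUl.
have dDB : [disjoint D & B] by apply: disjointWr dD; apply: subsetUr.
pose third := opposite a b A B D.
pose K u := if u == a then A else if u == b then B else D.
have SK u : u \in tri -> S u \subset K u.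
  rewrite !inE /K => /or3P[]/eqP->; rewrite ?eqxx //.
    by rewrite (eq_sym b) (negbTE nab).
  by rewrite (negbTE nca) (eq_sym c) (negbTE nbc).
have thirdK := opposite_disjoint nab nbc nac dBA dDA dDB.
have third3 := opposite_disjoint2 nab nbc nac dBA dDA dDB.
pose h u v := if (u \in tri) && (v \in tri) then third u v else g (f u) (f v).
have mix u v w : u \in tri -> v \in tri -> w \notin tri -> r u v -> r u w ->
    [disjoint third u v & g (f u) (f w)].
  move=> ut vt wN uv uw; apply: disjointWr (thirdK u v ut vt (ne _ _ uv)).
  apply: subset_trans (SK u ut); rewrite fa // fo //.
  by apply: (@finset.bigcup_sup _ _ w); rewrite uw.
exists h; split=> [u v uv|u v uv|u v w uv uw vw]; rewrite /h.
- rewrite andbC; case: ifPn => [_|N]; first by rewrite /third /opposite !inE !(orbC (_ == u)).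
  by apply: gS; apply: r'f; rewrite // andbC.
- case: ifPn => [/andP[ut vt]|N]; last by apply: g2; apply: r'f.
  by rewrite /third /opposite; case: ifP => // _; case: ifP.
case: (boolP (u \in tri)) => ut /=.
  case: (boolP (v \in tri)) => vt; case: (boolP (w \in tri)) => wt.
  - exact: third3 ut vt wt (ne _ _ uv) (ne _ _ uw) vw.
  - exact: mix.
  - by rewrite disjoint_sym; apply: mix.
  - by rewrite (outer u v w) ?eqxx in vw.
apply: gD.
- by apply: r'f; rewrite // (negbTE ut).
- by apply: r'f; rewrite // (negbTE ut).
apply: fne => //; apply/andP => -[vt wt].
by move: vw; rewrite (nd u v w) ?eqxx // rS.
Qed.

(** * Reduction to triangle-free graphs *)

(** Induction on the number of non-isolated vertices: removing a diamond isolates [x], and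
    contracting a triangle isolates [b]. *)
Lemma subcubic_seven (T : finType) (r : rel T) :
  symmetric r -> irreflexive r -> subcubic r ->
  exists g : T -> T -> {set seven}, pair_coloring r g.
Proof.
have [n] := ubnP #|[set u | [exists v, r u v]]|.
elim: n r => // n IH r le rS rI r3.
have [tf|] := pselect (triangle_free r); first exact: triangle_free_seven.
move=> /existsNP[a /existsNP[b /existsNP[c]]].
move=> /not_implyP[ab /not_implyP[bc /not_implyP[ca _]]].
have card_lt (r' : rel T) x : (forall u v, r' u v -> exists w, r u w) ->
    (forall v, ~~ r' x v) -> (exists v, r x v) ->
    #|[set u | [exists v, r' u v]]| < n.
  move=> sub xN [v xv]; rewrite -ltnS; apply: leq_ltn_trans le; apply: proper_card.
  apply/properP; split.
    apply/fintype.subsetP => u; rewrite !inE => /existsP[w /sub[w' uw']].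
    by apply/existsP; exists w'.
  exists x; rewrite inE; first by apply/existsP; exists v.
  by apply/existsPn.
have diamond x y z t : r x y -> r x z -> r y z -> r x t -> r y t -> z != t ->
    exists g : T -> T -> {set seven}, pair_coloring r g.
  move=> xy xz yz xt yt zt.
  apply: (extend_diamond card_seven rS rI r3 xy xz yz xt yt zt); apply: IH.
  - apply: (card_lt _ x); last by exists y.
      by move=> u v /and3P[uv _ _]; exists v.
    by move=> v; rewrite !inE eqxx !andbF.
  - by move=> u v; rewrite rS [(v \notin _) && _]andbC.
  - by move=> u; rewrite rI.
  - move=> u; apply: leq_trans (r3 u); apply: subset_leq_card.
    by apply/fintype.subsetP => v; rewrite !inE => /andP[].
have [ba cb ac] : [/\ r b a, r c b & r a c] by split; rewrite rS.
set tri := [:: a; b; c].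
have [[t [x [y [tN xt yt [rx [ry xy]]]]]]|nd] := pselect (exists t x y,
    [/\ t \notin tri, x \in tri, y \in tri & r x t /\ r y t /\ x != y]).
  move: tN; rewrite !inE !negb_or => /and3P[ta tb tc].
  have [ta' tb' tc'] : [/\ a != t, b != t & c != t] by rewrite !(eq_sym _ t).
  move: xt yt rx ry xy; rewrite !inE => /or3P[]/eqP-> /or3P[]/eqP-> rx ry; rewrite ?eqxx // => _.
  - exact: (diamond a b c t).
  - exact: (diamond a c b t).
  - exact: (diamond b a c t).
  - exact: (diamond b c a t).
  - exact: (diamond c a b t).
  - exact: (diamond c b a t).
have [|r3' ext] := extend_triangle card_seven rS rI r3 ab bc ca.
  move=> t x y tN xt yt rx ry; apply/eqP/negPn/negP => xy.
  by apply: nd; exists t, x, y.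
apply: ext; apply: IH => //.
- apply: (card_lt _ b); last by exists c.
    move=> u v /andP[_ /existsP[p /existsP[q /and3P[pq /eqP <- _]]]].
    by case: ifP => _; [exists b|exists q].
  move=> v; apply/negP => /andP[_ /existsP[p /existsP[q /and3P[_ /eqP E _]]]].
  move: E; case: ifPn => [_ E|]; first by rewrite E rI in ab.
  by rewrite !inE => /norP[/eqP].
- move=> u v; rewrite /contract eq_sym; congr (_ && _).
  by apply/existsP/existsP => -[p /existsP[q /and3P[pq fp fq]]];
    exists q; apply/existsP; exists p; rewrite rS pq fp fq.
- by move=> u; rewrite /contract eqxx.
Qed.

(** * Incidence colorings as pairs of colors *)

Lemma edgesP (G : sgraph) (e : {set G}) :
  reflect (exists u v : G, u -- v /\ e = [set u; v]) (e \in edges G).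
Proof.
apply: (iffP imsetP) => [[[u v] + ->]|[u [v [uv ->]]]].
  by rewrite inE => uv; exists u, v.
by exists (u, v); rewrite ?inE.
Qed.

Lemma incidenceP (G : sgraph) (i : incidence G) :
  exists2 w, (val i).1 -- w & (val i).2 = [set (val i).1; w].
Proof.
case: i => -[v e] /= /andP[/edgesP[u [w [uw /= ->]]] /=].
rewrite !inE => /orP[]/eqP->; first by exists w.
by exists u; [rewrite adj_sym|rewrite setUC].
Qed.

Lemma adj_neq (G : sgraph) (u v : G) : u -- v -> u != v.
Proof. by apply: contraTneq => ->; rewrite adj_irrefl. Qed.

Lemma set2_inj (T : finType) (x y z : T) : [set x; y] = [set x; z] -> y = z.
Proof.
move=> E; have := set22 x y; rewrite E !inE => /orP[/eqP yx|/eqP //].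
by have := set22 x z; rewrite -E yx !inE orbb => /eqP->.
Qed.

(** The two incidences of an edge share out its pair according to the ranks of the ends. The
    argument of type [C] is the default of [nth]. *)
Lemma cf_colorable_of_pair_coloring (G : sgraph) (C : finType) (g : G -> G -> {set C}) :
  C -> pair_coloring (@adj G) g -> cf_colorable G #|C|.
Proof.
move=> k0 [gS g2 gD].
pose other v (e : {set G}) := odflt v [pick w in e :\ v].
have otherE v w : v -- w -> other v [set v; w] = w.
  move=> vw; rewrite /other; case: pickP => [x|/(_ w)].
    by rewrite !inE => /andP[/negbTE-> /eqP].
  by rewrite !inE eq_sym (adj_neq vw) eqxx orbT.
pose cc v w := nth k0 (enum (g v w)) (enum_rank v < enum_rank w)%N.
have size2 v w : v -- w -> size (enum (g v w)) = 2 by move=> vw; rewrite -cardE g2.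
have ccg v w : v -- w -> cc v w \in g v w.
  by move=> vw; rewrite -mem_enum mem_nth // size2 // ltnS leq_b1.
have cc2 v w : v -- w -> cc v w != cc w v.
  move=> vw; have wv : w -- v by rewrite adj_sym.
  have vw' : (enum_rank v : nat) != enum_rank w.
    by rewrite (inj_eq val_inj) (inj_eq enum_rank_inj) adj_neq.
  rewrite /cc -(gS v w) // nth_uniq ?size2 ?enum_uniq ?ltnS ?leq_b1 //.
  by move: vw'; case: ltngtP.
apply/existsP; exists [ffun i => enum_rank (cc (val i).1 (other (val i).1 (val i).2))].
apply/forallP => i; apply/forallP => j; apply/implyP => /andP[ij /existsP[p]].
rewrite !ffunE (inj_eq enum_rank_inj) !inE.
have [w vw Ei] := incidenceP i; have [w' vw' Ej] := incidenceP j.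
set v := (val i).1 in vw Ei *; set v' := (val j).1 in vw' Ej *.
have [E|N] := eqVneq (val i).2 (val j).2.
  move=> _; have vv : v != v'.
    apply: contraNneq ij => E'; apply/eqP/val_inj.
    by rewrite [val i]surjective_pairing [val j]surjective_pairing -/v -/v' E E'.
  have Ew : v' = w.
    have : v' \in (val j).2 by rewrite Ej set21.
    by rewrite -E Ei !inE eq_sym (negbTE vv) => /eqP.
  have Ew' : w' = v by apply: (@set2_inj _ v'); rewrite -Ej -E Ei Ew setUC.
  rewrite -E Ei otherE // Ew setUC otherE; first by rewrite cc2.
  by rewrite adj_sym.
rewrite Ei Ej !otherE // => /andP[pi pj].
(* Both edges are rewritten with their common vertex first, where disjointness applies. *)
have vend (x y : G) (q : G) : x -- y -> q \in [set x; y] ->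
    exists z, [/\ q -- z, [set x; y] = [set q; z] & cc x y \in g q z].
  move=> xy; rewrite !inE => /orP[]/eqP->; first by exists y; rewrite ccg.
  by exists x; rewrite adj_sym setUC -gS ?ccg.
have [s [ps Es cs]] := vend _ _ _ vw pi; have [t [pt Et ct]] := vend _ _ _ vw' pj.
have st : s != t by apply: contraNneq N => E; rewrite Ei Ej Es Et E.
by apply: contraTneq cs => ->; rewrite (disjointFl (gD _ _ _ ps pt st)).
Qed.

(** An edge receives the colors of its two incidences, which conflict; incidences on two edges at a
    common vertex conflict as well. *)
Lemma pair_coloring_of_cf_colorable (G : sgraph) k : cf_colorable G k ->
  exists g : G -> G -> {set 'I_k}, pair_coloring (@adj G) g.
Proof.
case/existsP => c /forallP cP.
have cD (i j : incidence G) (p : G) : i != j -> p \in (val i).2 -> p \in (val j).2 -> c i != c j.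
  move=> ij pi pj; have /forallP/(_ j)/implyP := cP i; apply.
  by rewrite /conflict ij; apply/existsP; exists p; rewrite !inE pi pj.
exists (fun u v => c @: [set i : incidence G | (val i).2 == [set u; v]]).
split=> [u v _|u v uv|u v w uv uw vw].
- by rewrite setUC.
- have eE : [set u; v] \in edges G by apply/edgesP; exists u, v.
  have iu : is_incidence (u, [set u; v]) by rewrite /is_incidence /= eE set21.
  have iv : is_incidence (v, [set u; v]) by rewrite /is_incidence /= eE set22.
  rewrite card_in_imset => [|i j]; last first.
    rewrite !inE => /eqP Ei /eqP Ej E; apply/eqP/negPn/negP => ij.
    by have := cD i j u ij; rewrite Ei Ej set21 E eqxx => /(_ isT isT).
  suff -> : [set i : incidence G | (val i).2 == [set u; v]] =
      [set (Sub (u, [set u; v]) iu : incidence G); Sub (v, [set u; v]) iv].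
    rewrite cards2 -(inj_eq val_inj) !SubK xpair_eqE eqxx andbT.
    by rewrite (adj_neq uv).
  apply/setP => i; rewrite in_set; apply/eqP/set2P => [E|[]->]; rewrite ?SubK //.
  have [w _ Ei] := incidenceP i; have := set21 (val i).1 w.
  by rewrite -Ei E !inE => /orP[]/eqP E1; [left|right]; apply: val_inj;
    rewrite SubK [LHS]surjective_pairing E E1.
- rewrite -setI_eq0; apply/eqP/setP => k'; rewrite !inE; apply/negbTE/negP.
  move=> /andP[/imsetP[i + ->] /imsetP[j + E]]; rewrite !inE => /eqP Ei /eqP Ej.
  have ij : i != j.
    by apply: contraNneq vw => ij; apply/eqP/(@set2_inj _ u); rewrite -Ei -Ej ij.
  by have := cD i j u ij; rewrite Ei Ej !set21 E eqxx => /(_ isT isT).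
Qed.

(** * Six colors *)

Lemma pair_coloring_pullback (T T' : eqType) (C : finType) (r : rel T) (r' : rel T')
    (f : T' -> T) (g : T -> T -> {set C}) :
  injective f -> (forall u v, r' u v -> r (f u) (f v)) -> pair_coloring r g ->
  pair_coloring r' (fun u v => g (f u) (f v)).
Proof.
move=> fI fr [gS g2 gD]; split=> [u v uv|u v uv|u v w uv uw vw].
- exact/gS/fr.
- exact/g2/fr.
- by apply: gD; rewrite ?fr // (inj_eq fI).
Qed.

Definition six_colorable (T : eqType) (r : rel T) : Prop :=
  exists g : T -> T -> {set 'I_6}, pair_coloring r g.

Section SixColors.
Variables (T : eqType) (r : rel T) (g : T -> T -> {set 'I_6}).
Hypothesis gP : pair_coloring r g.

Lemma pair_disjoint u v w k : r u v -> r u w -> v != w ->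
  ~~ ((k \in g u v) && (k \in g u w)).
Proof.
case: gP => _ _ gD uv uw vw; apply/negP => /andP[kv].
by rewrite (disjointFr (gD _ _ _ uv uw vw) kv).
Qed.

(* Three disjoint pairs exhaust the six colors. *)
Lemma cubic_vertex u v1 v2 v3 k : r u v1 -> r u v2 -> r u v3 ->
  v1 != v2 -> v1 != v3 -> v2 != v3 ->
  (k \in g u v1) + (k \in g u v2) + (k \in g u v3) = 1.
Proof.
move=> r1 r2 r3 n12 n13 n23.
have d12 := pair_disjoint k r1 r2 n12; have d13 := pair_disjoint k r1 r3 n13.
have d23 := pair_disjoint k r2 r3 n23.
suff: (k \in g u v1) || (k \in g u v2) || (k \in g u v3).
  by case: (k \in g u v1) d12 d13; case: (k \in g u v2) d23; case: (k \in g u v3).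
have [_ g2 gD] := gP.
have d : [disjoint g u v1 :|: g u v2 & g u v3].
  by rewrite disjoints_subset subUset -!disjoints_subset !gD.
suff E : g u v1 :|: g u v2 :|: g u v3 = setT by have := in_setT k; rewrite -E !inE.
apply/eqP; rewrite eqEcard subsetT cardsT card_ord /=.
by rewrite !cardsU !disjoint_setI0 ?gD // !cards0 !g2.
Qed.

End SixColors.

(** * Graphs given by lists, and the base graph *)

Lemma inord_eq n i j : (i <= n)%N -> (j <= n)%N ->
  (inord i == inord j :> 'I_n.+1) = (i == j).
Proof. by move=> iN jN; rewrite -(inj_eq (@ord_inj n.+1)) !inordK. Qed.

Lemma graph_of_list_adj n (s : seq (nat * nat)) i j : (i <= n)%N -> (j <= n)%N ->
  @adj (graph_of_list n.+1 s) (inord i) (inord j) =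
  (i != j) && (((i, j) \in s) || ((j, i) \in s)).
Proof. by move=> iN jN; rewrite /= /sym_rel /= inord_eq // !inordK. Qed.

(* The coloring is transported to natural numbers, where adjacency computes. *)
Definition nat_adj n (s : seq (nat * nat)) : rel nat :=
  fun i j => [&& i <= n, j <= n, i != j & ((i, j) \in s) || ((j, i) \in s)].

Lemma graph_of_list_pair_coloring n s (g : graph_of_list n.+1 s -> _ -> {set 'I_6}) :
  pair_coloring (@adj (graph_of_list n.+1 s)) g ->
  pair_coloring (nat_adj n s) (fun i j => g (inord i) (inord j)).
Proof.
move=> [gS g2 gD]; split=> [u v|u v|u v w].
- by move=> /and3P[uN vN uv]; apply: gS; rewrite graph_of_list_adj.
- by move=> /and3P[uN vN uv]; apply: g2; rewrite graph_of_list_adj.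
- move=> /and3P[uN vN uv] /and3P[_ wN uw] vw.
  by apply: gD; rewrite ?graph_of_list_adj // inord_eq.
Qed.

(** A color on the edge [0 4] is absent from [1 4] and occurs once at each of the vertices 0 to 3.
    The three occurrences not due to [0 4] would come in pairs, from edges among these vertices. *)
Lemma K4_plus_not_six_colorable : ~ six_colorable (@adj K4_plus).
Proof.
case=> g /graph_of_list_pair_coloring; set h := fun i j => _ => hP.
have [hS h2 _] := hP.
have /card_gt0P[k] : 0 < #|h 0 4| by rewrite h2.
have := pair_disjoint hP (u := 4) (v := 0) (w := 1) k isT isT isT.
have := cubic_vertex hP (u := 0) (v1 := 4) (v2 := 2) (v3 := 3) k isT isT isT isT isT isT.
have := cubic_vertex hP (u := 1) (v1 := 4) (v2 := 2) (v3 := 3) k isT isT isT isT isT isT.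
have := cubic_vertex hP (u := 2) (v1 := 0) (v2 := 1) (v3 := 3) k isT isT isT isT isT isT.
have := cubic_vertex hP (u := 3) (v1 := 0) (v2 := 1) (v3 := 2) k isT isT isT isT isT isT.
rewrite (hS 4 0) // (hS 4 1) // (hS 2 0) // (hS 2 1) // (hS 3 0) // (hS 3 1) // (hS 3 2) //.
move: (k \in h 0 4) (k \in h 1 4) (k \in h 0 2) (k \in h 0 3) (k \in h 1 2)
  (k \in h 1 3) (k \in h 2 3).
by do 7!case.
Qed.

(* Used with [A] and [B] the pairs at the vertex of degree 2 of a configuration:
   its four colors lie in [P :|: Q], leaving no room for a common color. *)
Lemma disjoint_of_cover (C : finType) (P Q A B : {set C}) :
  #|P| = 2 -> #|Q| = 2 -> #|A| = 2 -> #|B| = 2 -> [disjoint A & B] ->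
  A :|: B \subset P :|: Q -> [disjoint P & Q].
Proof.
move=> P2 Q2 A2 B2 AB /subset_leq_card; rewrite cardsU (disjoint_setI0 AB) cards0 A2 B2.
rewrite -setI_eq0 -cards_eq0 => le.
by have := cardsUI P Q; rewrite P2 Q2; move: le; case: #|_ :&: _| => // n; lia.
Qed.

(* [x'] and [y'] are the neighbors of the two vertices by which a configuration
   is attached. *)
Definition ports (B : linked_graph) (x' y' : B) : Prop :=
  [/\ link1 B != link2 B, x' \notin [:: link1 B; link2 B],
      y' \notin [:: link1 B; link2 B], link1 B -- x' & link2 B -- y'].

(** * Constraints imposed by the configurations *)

(** A color on [uv] is absent from [uw] and [vw], so it is on [wy]; likewise a color on [uw] is on
    [vx]. *)
Lemma G_2_ports : exists x' y' : G_2, ports x' y' /\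
  forall g : G_2 -> G_2 -> {set 'I_6}, pair_coloring (@adj G_2) g ->
  [disjoint g (link1 G_2) x' & g (link2 G_2) y'].
Proof.
exists (inord 3), (inord 4); split.
  by split; rewrite ?graph_of_list_adj // ?inE ?inord_eq.
move=> g /graph_of_list_pair_coloring; set h := fun i j => _ => hP.
have [hS h2 hD] := hP; suff: [disjoint h 0 3 & h 1 4] by [].
apply: (@disjoint_of_cover _ _ _ (h 2 3) (h 2 4)); rewrite ?h2 ?hD //.
apply/fintype.subsetP => k; rewrite !inE.
have := pair_disjoint hP (u := 2) (v := 3) (w := 4) k isT isT isT.
have := cubic_vertex hP (u := 3) (v1 := 2) (v2 := 4) (v3 := 0) k isT isT isT isT isT isT.
have := cubic_vertex hP (u := 4) (v1 := 2) (v2 := 3) (v3 := 1) k isT isT isT isT isT isT.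
rewrite (hS 3 2) // (hS 4 2) // (hS 4 3) // (hS 3 0) // (hS 4 1) //.
move: (k \in h 2 3) (k \in h 2 4) (k \in h 0 3) (k \in h 1 4) (k \in h 3 4).
by do 5!case.
Qed.

(** A color on both [x u1] and [v1 y] is absent from the cycle [u1 u0 v1 v0], so [u0 w] and [v0 w]
    would both carry it, though they meet at [w]. *)
Lemma G_4_ports : exists x' y' : G_4, ports x' y' /\
  forall g : G_4 -> G_4 -> {set 'I_6}, pair_coloring (@adj G_4) g ->
  [disjoint g (link1 G_4) x' & g (link2 G_4) y'].
Proof.
exists (inord 3), (inord 5); split.
  by split; rewrite ?graph_of_list_adj // ?inE ?inord_eq.
move=> g /graph_of_list_pair_coloring; set h := fun i j => _ => hP.
have [hS h2 hD] := hP; suff: [disjoint h 0 3 & h 1 5] by [].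
rewrite -setI_eq0; apply/eqP/setP => k; rewrite !inE; apply/negbTE.
have := pair_disjoint hP (u := 6) (v := 2) (w := 4) k isT isT isT.
have := cubic_vertex hP (u := 2) (v1 := 3) (v2 := 5) (v3 := 6) k isT isT isT isT isT isT.
have := cubic_vertex hP (u := 3) (v1 := 0) (v2 := 2) (v3 := 4) k isT isT isT isT isT isT.
have := cubic_vertex hP (u := 4) (v1 := 3) (v2 := 5) (v3 := 6) k isT isT isT isT isT isT.
have := cubic_vertex hP (u := 5) (v1 := 1) (v2 := 2) (v3 := 4) k isT isT isT isT isT isT.
rewrite (hS 3 0) // (hS 5 1) // (hS 3 2) // (hS 4 3) // (hS 5 2) // (hS 5 4) //.
rewrite (hS 6 2) // (hS 6 4) //.
move: (k \in h 0 3) (k \in h 1 5) (k \in h 2 3) (k \in h 3 4) (k \in h 2 5)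
  (k \in h 4 5) (k \in h 2 6) (k \in h 4 6).
by do 8!case.
Qed.

(** A color occurs once at each of [u0], [u2], [v0], [v1], and edges among these count twice. By
    parity, a color on exactly one edge at [u1] is on exactly one of [x u2] and [v1 y], which gives
    the cover. *)
Lemma G_8_ports : exists x' y' : G_8, ports x' y' /\
  forall g : G_8 -> G_8 -> {set 'I_6}, pair_coloring (@adj G_8) g ->
  [disjoint g (link1 G_8) x' & g (link2 G_8) y'].
Proof.
exists (inord 4), (inord 6); split.
  by split; rewrite ?graph_of_list_adj // ?inE ?inord_eq.
move=> g /graph_of_list_pair_coloring; set h := fun i j => _ => hP.
have [hS h2 hD] := hP; suff: [disjoint h 0 4 & h 1 6] by [].
apply: (@disjoint_of_cover _ _ _ (h 3 2) (h 3 4)); rewrite ?h2 ?hD //.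
apply/fintype.subsetP => k; rewrite !inE.
have := pair_disjoint hP (u := 3) (v := 2) (w := 4) k isT isT isT.
have := cubic_vertex hP (u := 2) (v1 := 3) (v2 := 5) (v3 := 6) k isT isT isT isT isT isT.
have := cubic_vertex hP (u := 4) (v1 := 0) (v2 := 3) (v3 := 5) k isT isT isT isT isT isT.
have := cubic_vertex hP (u := 5) (v1 := 4) (v2 := 2) (v3 := 6) k isT isT isT isT isT isT.
have := cubic_vertex hP (u := 6) (v1 := 1) (v2 := 2) (v3 := 5) k isT isT isT isT isT isT.
rewrite (hS 2 3) // (hS 4 0) // (hS 4 3) // (hS 5 4) // (hS 5 2) // (hS 6 1) //.
rewrite (hS 6 2) // (hS 6 5) //.
move: (k \in h 0 4) (k \in h 1 6) (k \in h 3 2) (k \in h 3 4) (k \in h 4 5)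
  (k \in h 2 5) (k \in h 2 6) (k \in h 5 6).
by do 8!case.
Qed.

(** Equality is propagated along the two rails of the ladder, starting from the end at [x'] and
    [y']. *)
Lemma H_ports t : (1 <= t)%N -> exists x' y' : H_ t, ports x' y' /\
  forall g : H_ t -> H_ t -> {set 'I_6}, pair_coloring (@adj (H_ t)) g ->
  g (link1 (H_ t)) x' = g (link2 (H_ t)) y'.
Proof.
move=> t1.
pose z b i : H_ t := (b, Some (inord i : 'I_t.+1)); pose z' b : H_ t := (b, None).
have zS b i : (i < t)%N -> z b i.+1 -- z b i.
  move=> it; rewrite /= /sym_rel /= !xpair_eqE /= !(inj_eq (@Some_inj _)) inord_eq //; last exact: ltnW.
  by rewrite !inordK ?ltnS // ?(ltnW it) // !eqxx /= orbT andbT gtn_eqF.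
have zz i : (0 < i)%N -> (i < t)%N -> z false i -- z true i.
  move=> i0 it; apply/andP; split=> //; apply/orP; left.
  by rewrite /z /= eqxx inordK ?ltnS ?(ltnW it) // i0 -ltnS prednK.
have z'0 b c : z' b -- z c 0.
  by apply/andP; split; [rewrite xpair_eqE andbF|rewrite /= inordK].
have z'z' : z' false -- z' true by [].
have zN b i c j : (i <= t)%N -> (j <= t)%N -> (z b i == z c j) = (b == c) && (i == j).
  by move=> it jt; rewrite xpair_eqE (inj_eq (@Some_inj _)) inord_eq.
have lE b : (b, Some ord_max) = z b t.
  by congr (_, Some _); apply: val_inj; rewrite /= inordK.
have t1t : (t.-1 <= t)%N := leq_pred t.
exists (z false t.-1), (z true t.-1); split.
  rewrite /ports /= !lE.
  have N : t != t.-1 by rewrite -[X in X != _](prednK t1) gtn_eqF.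
  split; rewrite ?inE ?zN ?eqxx ?(eq_sym t.-1) ?(negbTE N) //.
  - by have := zS false t.-1; rewrite prednK // => /(_ (leqnn _)).
  - by have := zS true t.-1; rewrite prednK // => /(_ (leqnn _)).
move=> g gP; rewrite /= !lE; have [gS _ _] := gP.
suff E : forall i, (i < t)%N -> g (z false i.+1) (z false i) = g (z true i.+1) (z true i).
  by have := E t.-1; rewrite prednK // => /(_ (leqnn _)).
have zzS b i : (i < t)%N -> z b i -- z b i.+1 by move=> it; rewrite adj_sym zS.
have z0z' b c : z b 0 -- z' c by rewrite adj_sym z'0.
have z'z b : z' b -- z' (~~ b) by case: b.
elim=> [t0|i IH it].
  (* The vertices [x'], [y'], [x_0], [y_0] each see [k] once, and edges among them count twice. By
     parity [k] is on both leaving edges or on neither. *)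
  apply/setP => k.
  have N b c i : z' b != z c i by rewrite xpair_eqE andbF.
  have N0 : z false 0 != z true 0 by [].
  have F b := cubic_vertex gP k (z0z' b false) (z0z' b true) (zzS b 0 t0) isT (N _ _ _) (N _ _ _).
  have F' b := cubic_vertex gP k (z'z b) (z'0 b false) (z'0 b true) (N _ _ _) (N _ _ _) N0.
  have := (F false, F true, F' false, F' true).
  rewrite -[~~ false]/true -[~~ true]/false (gS (z' true) (z' false)) //.
  rewrite !(gS _ _ (z0z' _ _)) !(gS _ _ (zzS _ _ t0)) => -[[[]]].
  move: (k \in g (z' false) (z false 0)) (k \in g (z' false) (z true 0))
    (k \in g (z' true) (z false 0)) (k \in g (z' true) (z true 0))
    (k \in g (z false 1) (z false 0)) (k \in g (z true 1) (z true 0))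
    (k \in g (z' false) (z' true)).
  by do 7!case.
(* At the ends of a rung, the rung is common and the earlier rail edges have equal pairs, so the
   next ones do too. *)
have it' := ltnW it.
have {}IH := IH it'.
apply/setP => k.
have zz' : z true i.+1 -- z false i.+1 by rewrite adj_sym zz.
have N1 b c : z b i.+1 != z c i.+2.
  by rewrite zN ?negb_and ?ltn_eqF ?orbT // ltnW.
have N0 b c : z b i != z c i.+1 by rewrite zN ?negb_and ?ltn_eqF ?orbT ?(ltnW it').
have N2 b c : z b i != z c i.+2 by rewrite zN ?negb_and ?ltn_eqF ?orbT ?(ltnW it').
have F1 := cubic_vertex gP k (zS false i it') (zz i.+1 isT it) (zzS false i.+1 it)
  (N0 _ _) (N2 _ _) (N1 _ _).
have F2 := cubic_vertex gP k (zS true i it') zz' (zzS true i.+1 it)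
  (N0 _ _) (N2 _ _) (N1 _ _).
move: F1 F2; rewrite IH (gS _ _ zz') (gS _ _ (zS false i.+1 it)) (gS _ _ (zS true i.+1 it)).
by do 4!case: (_ \in _).
Qed.

(** * Splitting a coloring of an attachment *)

Section Attach.
Variables (A : sgraph) (B : linked_graph) (z1 z2 : A) (x' y' : B).
Hypotheses (z12 : z1 != z2) (pB : ports x' y').
Variable F : attach B z1 z2 -> attach B z1 z2 -> {set 'I_6}.
Hypothesis FP : pair_coloring (@adj (attach B z1 z2)) F.

Let inA (u : A) : @attach A B z1 z2 := inl u.

Let inB (b : B) : @attach A B z1 z2 :=
  if insub b is Some c then inr c else if b == link1 B then inl z1 else inl z2.

Lemma inA_adj u v : u -- v -> inA u -- inA v.
Proof.
move=> uv; apply/andP; split.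
  by apply: contraTneq uv => -[->]; rewrite adj_irrefl.
by apply/orP; left; apply/orP; left.
Qed.

Lemma represents_inB b : @represents A B z1 z2 b (inB b).
Proof.
rewrite /inB; case: insubP => [c _ <-|] /=; first exact: eqxx.
rewrite negb_and !negbK; case: (b =P link1 B) => [->|_ /= /eqP->] /=.
  by rewrite !eqxx.
by rewrite !eqxx orbT.
Qed.

Lemma inB_inj : injective inB.
Proof.
have [l12 _ _ _ _] := pB.
move=> b c; rewrite /inB; case: insubP => [b' _ Eb|]; case: insubP => [c' _ Ec|].
- by move=> [E]; rewrite -Eb -Ec E.
- by move=> _; case: ifP.
- by move=> _; case: ifP.
rewrite !negb_and !negbK.
case: (c =P link1 B) => [->|_] /=; case: (b =P link1 B) => [->|_] //=.
- by move=> _ _ [/esym/eqP]; rewrite (negbTE z12).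
- by move=> _ _ [/eqP]; rewrite (negbTE z12).
- by move=> /eqP-> /eqP->.
Qed.

Lemma inB_adj b c : b -- c -> inB b -- inB c.
Proof.
move=> bc; rewrite /= /sym_rel /=; apply/andP; split.
  by rewrite (inj_eq inB_inj) adj_neq.
apply/orP; left; apply/orP; right.
by apply/existsP; exists b; apply/existsP; exists c; rewrite bc !represents_inB.
Qed.

Lemma inB_link1 : inB (link1 B) = inA z1.
Proof. by rewrite /inB insubF ?eqxx. Qed.

Lemma inB_link2 : inB (link2 B) = inA z2.
Proof.
have [l12 _ _ _ _] := pB.
by rewrite /inB insubF ?eqxx ?andbF // eq_sym (negbTE l12).
Qed.

Lemma inB_inner b u : b \notin [:: link1 B; link2 B] -> inB b != inA u.
Proof.
rewrite !inE negb_or /inB => lb; case: insubP => [c _ _ //|].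
by rewrite lb.
Qed.

(** Both pieces embed in the attachment, where the edge from a link to its port and an edge of [A]
    at the identified vertex are distinct and adjacent. *)
Lemma attach_restrict : exists (FA : A -> A -> {set 'I_6}) (FB : B -> B -> {set 'I_6}),
  [/\ pair_coloring (@adj A) FA, pair_coloring (@adj B) FB,
      forall u, z1 -- u -> [disjoint FB (link1 B) x' & FA z1 u] &
      forall u, z2 -- u -> [disjoint FB (link2 B) y' & FA z2 u]].
Proof.
have [_ xN yN lx ly] := pB; have [_ _ FD] := FP.
exists (fun u v => F (inA u) (inA v)), (fun u v => F (inB u) (inB v)); split.
- by apply: pair_coloring_pullback FP => [u v [->]|] //; apply: inA_adj.
- by apply: pair_coloring_pullback FP; [apply: inB_inj|apply: inB_adj].
- move=> u zu; rewrite inB_link1; apply: FD; rewrite ?inB_inner ?inA_adj //.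
  by rewrite -inB_link1 inB_adj.
- move=> u zu; rewrite inB_link2; apply: FD; rewrite ?inB_inner ?inA_adj //.
  by rewrite -inB_link2 inB_adj.
Qed.

End Attach.

(** * Undoing the operations *)

Lemma degree2_cases (G : sgraph) (z a b v : G) :
  degree z = 2 -> a != b -> z -- a -> z -- b -> z -- v -> v = a \/ v = b.
Proof.
move=> z2 ab za zb zv.
have E : [set a; b] = neighbors z.
  apply/eqP; rewrite eqEcard cards2 ab -/(degree z) z2 andbT.
  by apply/fintype.subsetP => t; rewrite !inE => /orP[]/eqP->.
have : v \in neighbors z by rewrite inE.
by rewrite -E !inE => /orP[]/eqP->; [left|right].
Qed.

Lemma G_config_ports (B : linked_graph) : G_config B -> exists x' y' : B, ports x' y' /\
  forall g : B -> B -> {set 'I_6}, pair_coloring (@adj B) g ->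
  [disjoint g (link1 B) x' & g (link2 B) y'].
Proof. by case=> ->; [apply: G_2_ports|apply: G_4_ports|apply: G_8_ports]. Qed.

(** The edges at [z] inherit the pairs [P] and [Q] of the edges leaving the configuration; these
    already avoid the other edges at [z1] and [z2]. *)
Lemma six_colorable_sqcup (G : sgraph) (z : G) (z1 z2 : del_vertex z) (B : linked_graph) :
  degree z = 2 -> z1 != z2 -> z -- val z1 -> z -- val z2 -> G_config B ->
  six_colorable (@adj (attach B z1 z2)) -> six_colorable (@adj G).
Proof.
move=> dz z12 zz1 zz2 /G_config_ports[x' [y' [pB BP]]] [F FP].
have [FA [FB [FAP FBP D1 D2]]] := attach_restrict z12 pB FP.
have PQ := BP FB FBP; have [_ _ _ lx ly] := pB.
have [_ FB2 _] := FBP; have [AS A2 AD] := FAP.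
set P := FB (link1 B) x' in PQ D1; set Q := FB (link2 B) y' in PQ D2.
pose R (u : del_vertex z) := if u == z1 then P else Q.
(* [insub] fails exactly at [z], and [set0] fills in the non-edge from [z] to itself. *)
pose g (u v : G) : {set 'I_6} :=
  match insub u : option (del_vertex z), insub v : option (del_vertex z) with
  | Some u', Some v' => FA u' v'
  | Some u', None => R u'
  | None, Some v' => R v'
  | None, None => set0
  end.
have insz : insub z = None :> option (del_vertex z) by rewrite insubF // eqxx.
have zcase (u' : del_vertex z) : z -- val u' -> u' = z1 \/ u' = z2.
  move=> zu; have N : val z1 != val z2 by rewrite (inj_eq val_inj).
  by case: (degree2_cases dz N zz1 zz2 zu) => /val_inj; [left|right].
have adjA (u v : del_vertex z) : val u -- val v -> u -- v.
  by move=> uv; rewrite /= /sym_rel /= uv andbT -(inj_eq val_inj) adj_neq.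
have RD u' v' : z -- val u' -> val u' -- val v' -> [disjoint R u' & FA u' v'].
  move=> /zcase[]-> /adjA uv; rewrite /R ?eqxx; first exact: D1.
  by rewrite eq_sym (negbTE z12); exact: D2.
have R2 u : #|R u| = 2 by rewrite /R; case: ifP => _; apply: FB2.
have cases (u : G) : u = z \/ exists u' : del_vertex z, u = val u'.
  by have [->|uz] := eqVneq u z; [left|right; exists (Sub u uz)].
exists g; split=> [u v uv|u v uv|u v w uv uw vw]; rewrite /g.
- case: (cases u) uv => [->|[u' ->]]; case: (cases v) => [->|[v' ->]]; rewrite ?insz ?valK //.
  by move=> /adjA; apply: AS.
- case: (cases u) uv => [->|[u' ->]]; case: (cases v) => [->|[v' ->]]; rewrite ?insz ?valK //.
    by rewrite adj_irrefl.
  by move=> /adjA; apply: A2.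
case: (cases u) uv uw => [->|[u' ->]]; case: (cases v) vw => [->|[v' ->]];
  case: (cases w) => [->|[w' ->]]; rewrite ?insz ?valK ?eqxx ?adj_irrefl //.
- move=> vw /zcase[] Ev /zcase[] Ew; move: vw; rewrite Ev Ew ?eqxx // => _.
    by rewrite /R eqxx eq_sym (negbTE z12).
  by rewrite /R eqxx eq_sym (negbTE z12) disjoint_sym.
- by move=> _; rewrite adj_sym; apply: RD.
- by move=> _ uv; rewrite adj_sym disjoint_sym => zu; apply: RD.
- rewrite (inj_eq val_inj) => vw /adjA uv /adjA uw; exact: AD.
Qed.

(** The edge joining [z1] and [z2] receives the common pair of the two edges leaving [H_ t], which
    avoids the other edges at both ends. *)
Lemma six_colorable_vee (G : sgraph) (z1 z2 : G) t : z1 -- z2 -> (1 <= t)%N ->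
  six_colorable (@adj (@attach (del_edge z1 z2) (H_ t) z1 z2)) -> six_colorable (@adj G).
Proof.
move=> zz /H_ports[x' [y' [pB BP]]] [F FP].
have z12 := adj_neq zz.
have [FA [FB [FAP FBP D1 D2]]] := attach_restrict (A := del_edge z1 z2) z12 pB FP.
have PQ := BP FB FBP; have [_ _ _ lx ly] := pB.
have [_ FB2 _] := FBP; have [AS A2 AD] := FAP.
rewrite -PQ in D2; set P := FB (link1 (H_ t)) x' in D1 D2.
have P2 : #|P| = 2 by apply: FB2.
pose g (u v : G) : {set 'I_6} := if [set u; v] == [set z1; z2] then P else FA u v.
have adjA (u v : G) : u -- v -> [set u; v] != [set z1; z2] -> @adj (del_edge z1 z2) u v.
  by move=> uv N; rewrite /= /sym_rel /= uv N adj_neq.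
have PD (u v w : G) : [set u; v] = [set z1; z2] -> u -- w -> [set u; w] != [set z1; z2] ->
    [disjoint P & FA u w].
  move=> E uw N; have : u \in [set z1; z2] by rewrite -E set21.
  have {uw N} := adjA _ _ uw N.
  by rewrite !inE => uw /orP[]/eqP Eu; rewrite Eu in uw *; [apply: D1|apply: D2].
exists g; split=> [u v uv|u v uv|u v w uv uw vw]; rewrite /g.
- by rewrite [in RHS]setUC; case: ifPn => // N; apply: AS; apply: adjA.
- by case: ifPn => // N; apply: A2; apply: adjA.
case: (boolP ([set u; v] == _)) => [/eqP Ev|Nv]; case: (boolP ([set u; w] == _)) => [/eqP Ew|Nw].
- by rewrite -Ew in Ev; rewrite (set2_inj Ev) eqxx in vw.
- exact: PD Ev uw Nw.
- by rewrite disjoint_sym; apply: PD Ew uv Nv.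
- by apply: AD => //; apply: adjA.
Qed.

Lemma class_P_not_six_colorable (G : sgraph) : class_P G -> ~ six_colorable (@adj G).
Proof.
elim=> [|H z z1 z2 B _ IH dz z12 zz1 zz2 cB /six_colorable_sqcup|H z1 z2 t _ IH zz t1].
- exact: K4_plus_not_six_colorable.
- by move=> /(_ dz z12 zz1 zz2 cB)/IH.
- by move=> /(six_colorable_vee zz t1)/IH.
Qed.

(** * The least number of colors *)

Lemma cf_colorableW (G : sgraph) k l : (k <= l)%N -> cf_colorable G k -> cf_colorable G l.
Proof.
move=> kl /existsP[c /forallP cP]; apply/existsP.
exists [ffun i => widen_ord kl (c i)]; apply/forallP => i; apply/forallP => j.
apply/implyP => ij; have /forallP/(_ j)/implyP/(_ ij) := cP i.
by rewrite !ffunE -!(inj_eq val_inj).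
Qed.

Theorem theorem3p13 (R : realType) (G : sgraph) :
  class_P_plus R G -> chi_ic G = 7.
Proof.
case=> _ _ D3 [H HP [f fI fH]].
have G3 : subcubic (@adj G).
  by move=> v; rewrite -D3; apply: (@leq_bigmax G (@degree G)).
have [g gP] := subcubic_seven (@adj_sym G) (@adj_irrefl G) G3.
have c7 : cf_colorable G 7.
  (* [right] supplies the seventh color as the default color required. *)
  by rewrite -card_seven; apply: cf_colorable_of_pair_coloring gP; right.
have c6 : ~~ cf_colorable G 6.
  apply/negP => /pair_coloring_of_cf_colorable[h hP].
  apply: (class_P_not_six_colorable HP).
  by exists (fun u v => h (f u) (f v)); apply: pair_coloring_pullback hP.
rewrite /chi_ic; case: ex_minnP => k ck kmin; apply/eqP; rewrite eqn_leq kmin //.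
by rewrite ltnNge; apply: contra c6 => k6; apply: cf_colorableW ck.
Qed.
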